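(* Let $W$ be a complex vector space of dimension 6 and let $\mathbb{P}(A)\subset\mathrm{Pf}\subset\mathbb{P}(\bigwedge^2W^* )$ be a stable linear space of dimension $n$ such that $\mathbb{P}(A)\cap\mathrm{Gr}(2,W^* )\neq\emptyset$. Then $\mathbb{P}(A)\cap\mathrm{Gr}(2,W^* )$ has codimension at least 3 in $\mathbb{P}(A)$, and each of its components of maximal dimension is smooth.
   Context: The base field is $\mathbb{C}$. $\mathbb{P}(\bigwedge^2 W^* )\simeq\mathbb{P}^{14}$ is the projective space of lines in the space $\bigwedge^2W^*$ of skew-symmetric bilinear forms on $W$. The rank of a form is the (even) rank of the corresponding $6\times 6$ skew-symmetric matrix. $\mathrm{Pf}=\{\omega\in\mathbb{P}(\bigwedge^2W^* ): \mathrm{rk}(\omega)\le 4\}$ is the Pfaffian hypersurface, and $\mathrm{Gr}(2,W^* )=\{\omega: \mathrm{rk}(\omega)=2\}$ is the Plücker-embedded Grassmannian of 2-dimensional subspaces of $W^*$. An $n$-dimensional linear space is $\mathbb{P}(A)\subset \mathbb{P}(\bigwedge^2W^* )$ with $A\subset\bigwedge^2W^*$ a linear subspace of dimension $n+1$. The intersection $\mathbb{P}(A)\cap\mathrm{Gr}(2,W^* )$ is the closed locus in $\mathbb{P}(A)$ defined by the restrictions to $\mathbb{P}(A)$ of the Plücker quadrics (the base locus of this linear system of quadrics). Action and stability: $g\in GL(W)$ acts on forms by $M_\omega\mapsto gM_\omega g^T$ on the representing skew-symmetric matrices. Let $V_{n+1}$ be a complex vector space of dimension $n+1$. Choosing an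 injective linear map $\phi:V_{n+1}\to\bigwedge^2W^*$ with image $A$, one regards $A$ as a vector of $V_{n+1}^*\otimes\bigwedge^2W^*$, on which $SL(W)$ acts through the second factor. $\mathbb{P}(A)$ is stable if the orbit $SL(W)\cdot A$ is closed in $V_{n+1}^*\otimes\bigwedge^2W^*$ and the stabilizer of $A$ (as a vector of this space) in $SL(W)$ is finite; this does not depend on the choice of $\phi$. *)

(* Defs.v *)
From mathcomp Require Export all_boot all_order all_algebra.
From mathcomp Require Export mpoly.
From mathcomp Require Export boolp classical_sets cardinality reals complex.

Set Implicit Arguments.
Unset Strict Implicit.
Unset Printing Implicit Defensive.

Import GRing.Theory.
Local Open Scope ring_scope.
Local Open Scope classical_set_scope.

Section ZariskiGeometry.
Variables (K : fieldType) (V : vectType K).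

(* Polynomial functions on V are polynomials in the coordinates with respect
   to the basis [vbasis fullv]; the notions below do not depend on the basis. *)
Definition polyfun : Type := {mpoly K[\dim (fullv : {vspace V})]}.

Definition coords (v : V) (i : 'I_(\dim (fullv : {vspace V}))) : K :=
  coord (vbasis fullv) i v.

Definition pevalv (f : polyfun) (v : V) : K := f.@[coords v].

(* The differential of f at v, applied to w. *)
Definition pdiff (f : polyfun) (v w : V) : K :=
  \sum_i (mderiv i f).@[coords v] * coords w i.

Definition homogeneous (f : polyfun) : Prop := exists d : nat, f \is d.-homog.

Definition zariski_closed (S : set V) : Prop :=
  exists P : set polyfun, S = [set v | forall f, P f -> pevalv f v = 0].

(* The projective space of lines in V. *)
Definition proj : Type := {L : {vspace V} | \dim L == 1%N}.

Definition vanishes_at (f : polyfun) (x : proj) : Prop :=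
  forall v, v \in val x -> pevalv f v = 0.

Definition proj_closed (Z : set proj) : Prop :=
  exists2 P : set polyfun, P `<=` [set f | homogeneous f]
    & Z = [set x | forall f, P f -> vanishes_at f x].

Definition projlin (A : {vspace V}) : set proj :=
  [set x | (val x <= A)%VS].

Definition irreducible_closed (Z : set proj) : Prop :=
  [/\ proj_closed Z, Z !=set0
    & forall Z1 Z2 : set proj, proj_closed Z1 -> proj_closed Z2 ->
        Z `<=` Z1 `|` Z2 -> Z `<=` Z1 \/ Z `<=` Z2].

Definition irr_component (Z X : set proj) : Prop :=
  [/\ irreducible_closed Z, Z `<=` X
    & forall Z', irreducible_closed Z' -> Z `<=` Z' -> Z' `<=` X -> Z' = Z].

(* X contains a chain of irreducible closed sets Z_0 < Z_1 < ... < Z_d. *)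
Definition irr_chain (X : set proj) (d : nat) : Prop :=
  exists Z : 'I_d.+1 -> set proj,
    (forall i, irreducible_closed (Z i) /\ Z i `<=` X) /\
    (forall i j : 'I_d.+1, (i < j)%N -> Z i `<` Z j).

(* Krull dimension of a nonempty closed set X. *)
Definition has_dim (X : set proj) (d : nat) : Prop :=
  irr_chain X d /\ forall e, irr_chain X e -> (e <= d)%N.

(* The affine cone of the embedded projective tangent space of Z (with its
   reduced structure) at x: the common kernel of the differentials at a
   generator of x of all the homogeneous polynomials vanishing on Z. *)
Definition affine_tangent_space (Z : set proj) (x : proj) : set V :=
  [set w | forall f, homogeneous f -> (forall y, Z y -> vanishes_at f y) ->
           forall v, v \in val x -> v != 0 -> pdiff f v w = 0].

(* Jacobian criterion; the affine cone over the tangent space has one more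
   dimension than the tangent space. *)
Definition smooth (Z : set proj) : Prop :=
  exists2 d, has_dim Z d &
    forall x, Z x -> exists2 T : {vspace V},
      [set` T] = affine_tangent_space Z x & \dim T = d.+1.

End ZariskiGeometry.

(* W is C^6 and a skew-symmetric form on W is identified with its matrix. *)
Section SkewForms.
Variable C : fieldType.

Definition skew_forms : set 'M[C]_6 := [set M | M^T = - M].

Definition Pf : set (proj 'M[C]_6) :=
  [set x : proj _ | forall M : 'M[C]_6, M \in val x ->
     skew_forms M /\ (\rank M <= 4)%N].

Definition Gr : set (proj 'M[C]_6) :=
  [set x : proj _ | forall M : 'M[C]_6, M \in val x -> M != 0 ->
     skew_forms M /\ \rank M = 2].

(* Elements of V^* (x) /\^2 W^* are linear maps phi : V -> /\^2 W^*; they form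
   a linear subspace of 'Hom(V, 'M_6), so that being closed means the same in
   both spaces. *)
Definition SL_orbit (V : vectType C) (phi : 'Hom(V, 'M[C]_6)) :
    set 'Hom(V, 'M[C]_6) :=
  [set psi | exists2 g : 'M[C]_6, \det g = 1
                                & forall v, psi v = g *m phi v *m g^T].

Definition SL_stabilizer (V : vectType C) (phi : 'Hom(V, 'M[C]_6)) :
    set 'M[C]_6 :=
  [set g | \det g = 1 /\ forall v, g *m phi v *m g^T = phi v].

Definition stable (A : {vspace 'M[C]_6}) : Prop :=
  exists phi : 'Hom('rV[C]_(\dim A), 'M[C]_6),
    [/\ lker phi = 0%VS, limg phi = A,
        zariski_closed (SL_orbit phi) & finite_set (SL_stabilizer phi)].

End SkewForms.

Arguments Pf {C}.
Arguments Gr {C}.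
Arguments skew_forms {C}.

(* Main.v *)
(* Let phi parametrize A.  By stability (Hilbert-Mumford), A has no common isotropic
   3-space and no vector w of W has all its contractions with A on a line.  Normalize a
   rank two element of A to e0^e1.  As all Pfaffians vanish, the restrictions of A to the
   kernel <e2,...,e5> are decomposable, and since there is no isotropic 3-space they form
   the space of all p in the second exterior power of <e2,e3,e4>.  Hence
     M = (al1 e0 + al2 e1)^e5 + e0^a + e1^b + c e0^e1 + p
   with a, b in <e2,e3,e4>, and Pf(M) = 0 reads al1 (b.p) = al2 (a.p).  As al1 and al2 are
   independent, a.p = al1 lam and b.p = al2 lam for a linear form lam.  After a change of
   basis there are two cases:
   - a = b = 0, and the elements of rank two form two disjoint linear spaces, each of
     codimension 3 since (c, al1, al2) and p are surjective;
   - al_i = u_i.p, a = lam u1, b = lam u2; then dim A = 5 and M has rank two if and only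
     if p = k (u1 x u2) and c k = lam^2, which is a conic.
   A chain of k + 1 irreducible closed sets in P(B) makes the Hilbert function grow like
   a polynomial of degree k, which bounds k by dim P(B). *)
Require Import Defs.
From HB Require Import structures.
From mathcomp Require Import ring.
Set Implicit Arguments.
Unset Strict Implicit.
Unset Printing Implicit Defensive.
Import Order.TTheory GRing.Theory Num.Theory.
Local Open Scope ring_scope.
Local Open Scope classical_set_scope.

(** * Polynomials along curves *)

(** Every passage to a limit or to a generic point is reduced to one variable: a polynomial is
    pulled back to an explicit curve, vanishes at enough natural parameters, and is therefore zero,
    in characteristic zero. This yields limits in closed orbits, irreducibility of sets whose points
    are joined by curves, and tangent vectors as velocities. In the algebra the obstacle is that
    Pf(M) = 0 is a cubic identity. The rank two element breaks it up: the Pfaffian is affine in the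
    coefficient of e0^e1, so comparing M with its translate by that element isolates the Pfaffian on
    <e2,...,e5>. The two cases differ by whether lam vanishes on the kernel of p. If it does, lam =
    u.p, and a shear absorbs a and b. If it does not, al1 and al2 are themselves functions of p, and
    u1 x u2 spans the values of p at which both vanish. The bound 3 is the dimension of the second
    exterior power of a 3-space in the first case, and 4 - 1 for a conic in a projective 4-space in
    the second. *)

Section PolynomialCurves.
Variables (F : fieldType) (V : vectType F).
Implicit Types (f g : polyfun V) (v w : V) (c : nat -> V) (t : F).

Definition curve c k t : V := \sum_(j < k) t ^+ j *: c j.

(** The pullback of [f] to the curve as a polynomial in the parameter, so that root counting applies
    to it. *)
Definition along f c k : {poly F} :=
  mmap (@polyC F) (fun i => \poly_(j < k) coords (c j) i) f.

Lemma coordsZ t v i : coords (t *: v) i = t * coords v i.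
Proof. by rewrite /coords linearZ. Qed.

Lemma coords_sum I (r : seq I) (P : pred I) (c : I -> V) i :
  coords (\sum_(j <- r | P j) c j) i = \sum_(j <- r | P j) coords (c j) i.
Proof. by rewrite /coords linear_sum. Qed.

Lemma horner_along f c k t : (along f c k).[t] = pevalv f (curve c k t).
Proof.
rewrite /along /mmap /pevalv mevalE horner_sum; apply: eq_bigr => m _.
rewrite hornerCM horner_prod; congr (_ * _); apply: eq_bigr => i _.
rewrite horner_exp horner_poly coords_sum; congr (_ ^+ _).
by apply: eq_bigr => j _; rewrite coordsZ mulrC.
Qed.

(** Chain rule. The polynomials satisfying it ([D]) contain 1 and the variables and are stable under
    products, hence contain the monomials; linearity does the rest. *)
Lemma deriv_along f c k t :
  (along f c k)^`().[t] =
  \sum_i (mderiv i f).@[coords (curve c k t)] *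
         (\poly_(j < k) coords (c j) i)^`().[t].
Proof.
pose q i := \poly_(j < k) coords (c j) i.
pose ev g := mmap (@polyC F) q g.
have H g : pevalv g (curve c k t) = (ev g).[t] by rewrite -horner_along.
under eq_bigr => i _ do rewrite -/(pevalv _ _) H -hornerM.
rewrite -horner_sum; congr (_.[t]); rewrite -/q {H} /along -/q -/(ev f).
have evZ (a : F) g : ev (a *: g) = a%:P * ev g by exact: mmapZ.
pose D g := (ev g)^`() = \sum_i ev (mderiv i g) * (q i)^`().
have D1 : D 1.
  rewrite /D /ev rmorph1 derivC big1 // => i _.
  by rewrite -mpolyC1 mderivC rmorph0 mul0r.
have DM f1 g : D f1 -> D g -> D (f1 * g).
  rewrite /D /ev rmorphM /= derivM => -> ->.
  rewrite mulr_suml mulr_sumr -big_split; apply: eq_bigr => i _.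
  rewrite mderivM rmorphD !rmorphM /=; ring.
have DX j : D 'X_j.
  rewrite /D /ev mmapX mmap1U (bigD1 j) //= big1 => [|i nij].
    rewrite mderivX mnm1E eqxx scale1r (_ : U_(j) - U_(j) = 0)%MM; last
      by apply/mnmP => k'; rewrite mnmBE subnn mnm0E.
    by rewrite mpolyX0 rmorph1 mul1r addr0.
  by rewrite mderivX mnm1E eq_sym (negPf nij) scale0r rmorph0 mul0r.
change (D f); elim/mpolyind: f => [|a m f _ _ IH].
  by rewrite /D /ev big1 ?rmorph0 ?linear0 // => i _; rewrite mderiv0 rmorph0 mul0r.
have: D ('X_[m]).
  rewrite mpolyXE_id; apply: (big_ind D) => // i _.
  elim: (m i) => [|k' IHk]; first by rewrite expr0.
  by rewrite exprS; apply: DM.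
rewrite /D /ev rmorphD /= derivD IH => DXm.
rewrite -/(ev _) evZ derivM derivC mul0r add0r DXm mulr_sumr -big_split.
apply: eq_bigr => i _ /=; rewrite mderivD mderivZ rmorphD /= mulrDl.
by rewrite -/(ev (a *: _)) evZ mulrA.
Qed.

Lemma curve0 c k : (0 < k)%N -> curve c k 0 = c 0.
Proof.
case: k => // k _; rewrite /curve big_ord_recl expr0 scale1r big1 ?addr0 // => i _.
by rewrite lift0 expr0n scale0r.
Qed.

Lemma pdiff_along f c k : (1 < k)%N -> pdiff f (c 0%N) (c 1%N) = (along f c k)^`().[0].
Proof.
move=> k1; rewrite deriv_along curve0 ?(ltnW k1) //; apply: eq_bigr => i _.
by rewrite horner_coef0 coef_deriv coef_poly k1.
Qed.


Lemma size_along_line f c d : f \is d.-homog -> (size (along f c 2) <= d.+1)%N.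
Proof.
move=> /dhomogP hf; rewrite /along /mmap big_seq.
have szM (p q : {poly F}) a b : (size p <= a.+1)%N -> (size q <= b.+1)%N ->
    (size (p * q)%R <= (a + b).+1)%N.
  move=> pa qb; apply: leq_trans (size_polyMleq p q) _.
  by rewrite -subn1 leq_subLR add1n -addnS -addSn leq_add.
apply: leq_trans (size_sum _ _ _) _; apply/bigmax_leqP_seq => m _ /hf <- /=.
rewrite -[X in (_ <= X.+1)%N]add0n; apply: (szM); first exact: size_polyC_leq1.
rewrite /mmap1 /= mdegE.
apply: (big_ind2 (fun (p : {poly F}) a => (size p <= a.+1)%N)) => [|p a q b|i _].
- by rewrite size_poly1.
- exact: szM.
rewrite -[m i]muln1; elim: {1 2}(m i) => [|k IH]; first by rewrite expr0 size_poly1.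
by rewrite exprS mulSn; apply: (szM) => //; apply: size_poly.
Qed.

Lemma pevalv_homog f d a v : f \is d.-homog -> pevalv f (a *: v) = a ^+ d * pevalv f v.
Proof.
move=> /dhomogP hf; rewrite /pevalv !mevalE mulr_sumr; rewrite !big_seq.
apply: eq_bigr => m /hf <-; rewrite mulrCA; congr (_ * _).
rewrite /= mdegE -prodrXr -big_split; apply: eq_bigr => i _.
by rewrite coordsZ exprMn.
Qed.

Definition linform (L : {scalar V}) : polyfun V :=
  \sum_(i < \dim (fullv : {vspace V})) L (vbasis fullv)`_i *: 'X_i.

Lemma pevalv_linform L v : pevalv (linform L) v = L v.
Proof.
rewrite [in RHS](coord_vbasis (memvf v)) linear_sum /pevalv /linform linear_sum.
by apply: eq_bigr => i _; rewrite /= mevalZ mevalXU linearZ /= mulrC.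
Qed.

Lemma linform_homog L : linform L \is 1.-homog.
Proof.
apply: rpred_sum => i _; apply: rpredZ; by rewrite dhomogX /= mdeg1.
Qed.

Lemma pdiff_linform L v w : pdiff (linform L) v w = L w.
Proof.
rewrite -[RHS]pevalv_linform /pdiff /pevalv /linform [meval _ _]linear_sum.
apply: eq_bigr => i _.
rewrite [mderiv i _]linear_sum (bigD1 i) //= mderivZ mderivX mnm1E eqxx scale1r.
rewrite (_ : U_(i) - U_(i) = 0)%MM; last by apply/mnmP => k'; rewrite mnmBE subnn mnm0E.
rewrite mpolyX0 big1 => [|j nij]; last first.
  by rewrite mderivZ mderivX mnm1E (negPf nij) scale0r scaler0.
by rewrite addr0 !mevalZ meval1 mulr1 mevalXU.
Qed.

Lemma pevalvM f g v : pevalv (f * g) v = pevalv f v * pevalv g v.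
Proof. exact: mevalM. Qed.

Lemma pevalvX f v n : pevalv (f ^+ n) v = pevalv f v ^+ n.
Proof. exact: rmorphXn. Qed.

Lemma pevalv_lin (I : Type) (r : seq I) (a : I -> F) (f : I -> polyfun V) v :
  pevalv (\sum_(i <- r) a i *: f i) v = \sum_(i <- r) a i * pevalv (f i) v.
Proof.
by rewrite /pevalv linear_sum; apply: eq_bigr => i _; rewrite /= mevalZ.
Qed.

Lemma pdiffB f g v w : pdiff (f - g) v w = pdiff f v w - pdiff g v w.
Proof.
rewrite /pdiff -sumrB; apply: eq_bigr => i _.
by rewrite mderivB mevalB mulrBl.
Qed.

Lemma pdiffM f g v w :
  pdiff (f * g) v w = pdiff f v w * pevalv g v + pevalv f v * pdiff g v w.
Proof.
rewrite /pdiff mulr_suml mulr_sumr -big_split; apply: eq_bigr => i _.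
rewrite mderivM mevalD !mevalM /pevalv /=; ring.
Qed.

End PolynomialCurves.

(** Characteristic zero enters here: the naturals below [size p] are distinct roots, one more than
    the degree allows. The explicit bound on [n] is what makes finite grids of test points
    possible. *)
Lemma poly_eq0_natr (F : numFieldType) (p : {poly F}) :
  (forall n, (n < size p)%N -> p.[n%:R] = 0) -> p = 0.
Proof.
move=> p0; apply/eqP/contraT => nz.
have := @max_poly_roots _ p [seq n%:R | n <- iota 0 (size p)] nz.
rewrite size_map size_iota ltnn; apply.
  by apply/allP => r /mapP[n]; rewrite mem_iota => /p0 /eqP pn ->.
by rewrite map_inj_uniq ?iota_uniq // => m n /eqP; rewrite eqr_nat => /eqP.
Qed.

Lemma expn_leq_ffact n k : (n ^ k <= (n + k) ^_ k)%N.
Proof.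
elim: k => // k IH; rewrite expnS ffactnS leq_mul ?leq_addr //.
by rewrite addnS.
Qed.

(** The left side grows like n^k / k! and the right side like a multiple of n^N. *)
Lemma bin_growth k N e :
  (forall n, 'C(n + k, k) <= (n * e).+1 ^ N)%N -> (k <= N)%N.
Proof.
move=> H; rewrite leqNgt; apply/negP => ltNk.
(* Chosen so that n^k <= n^N (e+1)^N k! < n^(N+1), which is absurd for N < k. *)
set n := ((e.+1 ^ N) * k`!).+1.
have n0 : (0 < n)%N by [].
have: (n ^ k <= (n ^ N) * (e.+1 ^ N) * k`!)%N.
  apply: leq_trans (expn_leq_ffact n k) _; rewrite -bin_ffact leq_mul2r.
  apply/orP; right; apply: leq_trans (H n) _.
  have [->|N0] := posnP N; first by rewrite !expn0.
  by rewrite -expnMn leq_exp2r // mulnS -add1n leq_add2r.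
rewrite leqNgt => /negP; apply.
apply: (@leq_trans (n ^ N.+1)); last by rewrite leq_pexp2l.
by rewrite expnSr -mulnA ltn_pmul2l ?expn_gt0.
Qed.

(** * Irreducible projective sets *)

Section ProjectiveSets.
Variables (F : numFieldType) (V : vectType F).
Implicit Types (f g h : polyfun V) (v w : V) (x y z : proj V) (Z : set (proj V)).
Implicit Types (B : {vspace V}).

Definition zero_on f Z := forall x, Z x -> vanishes_at f x.

Definition line v (nz : v != 0) : proj V.
Proof. by exists <[v]>%VS; rewrite dim_vline nz. Defined.

Lemma proj_gen x : exists2 v, v != 0 & val x = <[v]>%VS.
Proof.
case: x => L /= /eqP dL; exists (vpick L).
  by rewrite vpick0 -dimv_eq0 dL.
apply/esym/eqP; rewrite eqEdim -memvE memv_pick dim_vline vpick0 -dimv_eq0 dL //.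
Qed.

Lemma vanishes_gen f x v : homogeneous f -> val x = <[v]>%VS ->
  vanishes_at f x <-> pevalv f v = 0.
Proof.
move=> [d hf] xv; split=> [|fv w]; first by apply; rewrite xv memv_line.
by rewrite xv => /vlineP[a ->]; rewrite (pevalv_homog _ _ hf) fv mulr0.
Qed.

Lemma homogeneousM f g : homogeneous f -> homogeneous g -> homogeneous (f * g).
Proof. by move=> [d hf] [e hg]; exists (d + e)%N; apply: dhomogM. Qed.

Lemma vanishesM f g x : homogeneous f -> homogeneous g ->
  vanishes_at (f * g) x -> vanishes_at f x \/ vanishes_at g x.
Proof.
move=> hf hg; have [v nz xv] := proj_gen x.
move=> /(vanishes_gen (homogeneousM hf hg) xv); rewrite pevalvM => /eqP.
rewrite mulf_eq0 => /orP[] /eqP h0; [left|right].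
  by apply/(vanishes_gen hf xv).
by apply/(vanishes_gen hg xv).
Qed.

Lemma proj_closed_zeros f : homogeneous f -> proj_closed [set x | vanishes_at f x].
Proof.
move=> hf; exists [set f]; first by move=> _ ->.
by apply/seteqP; split=> x /= H => [_ ->//|]; apply: H.
Qed.

Lemma proj_closedI Z1 Z2 : proj_closed Z1 -> proj_closed Z2 -> proj_closed (Z1 `&` Z2).
Proof.
move=> [P1 h1 ->] [P2 h2 ->]; exists (P1 `|` P2); first by move=> f [/h1|/h2].
apply/seteqP; split=> x /= => [[H1 H2] f [/H1|/H2]//|H].
by split=> f Pf; apply: H; [left|right].
Qed.

Lemma irreducible_prime Z f g : irreducible_closed Z -> homogeneous f ->
  homogeneous g -> zero_on (f * g) Z -> zero_on f Z \/ zero_on g Z.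
Proof.
move=> [_ _ irr] hf hg fg0.
exact: (irr _ _ (proj_closed_zeros hf) (proj_closed_zeros hg))
  (fun x Zx => vanishesM hf hg (fg0 x Zx)).
Qed.

Lemma closed_separate Z x : proj_closed Z -> ~ Z x ->
  exists f, [/\ homogeneous f, zero_on f Z & ~ vanishes_at f x].
Proof.
move=> [P hP ->] /= /existsNP[f /not_implyP[Pf nf]].
by exists f; split=> //; [apply: hP|move=> y; apply].
Qed.

(** Take [x] outside Z1 and [y] outside Z2, with forms [f], [g] vanishing on Z1, Z2 but not at [x],
    [y]. On a curve from [x] to [y] inside the union the product of the pullbacks vanishes, so one
    factor is zero, which fails at parameter 0 or 1. Asking only for membership in [val z] lets the
    curve pass through the zero vector. *)
Lemma curve_connected_irreducible Z : proj_closed Z -> Z !=set0 ->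
  (forall x y, Z x -> Z y -> exists c k,
     [/\ val x = <[curve c k 0]>%VS, val y = <[curve c k 1]>%VS
       & forall t, exists2 z, Z z & curve c k t \in val z]) ->
  irreducible_closed Z.
Proof.
move=> clZ neZ H; split=> // Z1 Z2 cl1 cl2 Z12.
apply: contrapT => /not_orP[/existsNP[x /not_implyP[Zx Z1x]]].
move=> /existsNP[y /not_implyP[Zy Z2y]].
have [f [hf f0 fx]] := closed_separate cl1 Z1x.
have [g [hg g0 gy]] := closed_separate cl2 Z2y.
have [c [k [cx cy cz]]] := H x y Zx Zy.
have: along f c k * along g c k = 0.
  apply: poly_eq0_natr => n _; rewrite hornerM !horner_along.
  have [z Zz zc] := cz n%:R.
  by have [/f0|/g0] := Z12 z Zz => ->; rewrite ?mul0r ?mulr0.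
move=> /eqP; rewrite mulf_eq0 => /orP[] /eqP p0.
  by apply: fx; apply/(vanishes_gen hf cx); rewrite -horner_along p0 horner0.
by apply: gy; apply/(vanishes_gen hg cy); rewrite -horner_along p0 horner0.
Qed.

Lemma vspace_functional B v : v \notin B ->
  exists2 L : {scalar V}, (forall w, w \in B -> L w = 0) & L v != 0.
Proof.
move=> vB; pose u := v - projv B v.
have nz : u != 0.
  by apply: contra vB; rewrite subr_eq0 => /eqP ->; apply: memv_proj.
have [i ui] : exists i, coords u i != 0.
  apply/existsP; apply: contraR nz => /existsPn H.
  rewrite (coord_vbasis (memvf u)) big1 // => i _.
  by have /negPn/eqP := H i; rewrite /coords => ->; rewrite scale0r.
have lin : scalar (fun w => coords (w - projv B w) i).
  move=> a w1 w2; rewrite /coords -linearP; congr (coord _ _ _).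
  by rewrite linearP scalerBr opprD addrACA.
pose Lm := GRing.isLinear.Build F V F *%R _ lin.
pose L : {scalar V} := HB.pack (fun w => coords (w - projv B w) i) Lm.
exists L => [w wB|] //=.
by rewrite projv_id // subrr /coords linear0.
Qed.

Lemma proj_closed_projlin B : proj_closed (projlin B).
Proof.
exists [set f | exists2 L : {scalar V}, f = linform L & forall w, w \in B -> L w = 0].
  by move=> _ [L -> _]; exists 1%N; apply: linform_homog.
apply/seteqP; split=> x /= => [xB _ [L -> LB] v vx|H].
  by rewrite pevalv_linform LB // (subvP xB).
apply/subvP => v vx; apply: contraT => /vspace_functional[L LB].
by rewrite -pevalv_linform (H (linform L)) ?eqxx //; exists L.
Qed.

Lemma irreducible_projlin B : B != 0%VS -> irreducible_closed (projlin B).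
Proof.
move=> nzB; have nzb : vpick B != 0 by rewrite vpick0.
apply: curve_connected_irreducible; first exact: proj_closed_projlin.
  by exists (line nzb); rewrite /projlin /= -memvE memv_pick.
move=> x y; have [v nzv xv] := proj_gen x; have [w nzw yw] := proj_gen y.
rewrite /projlin /= xv yw -!memvE => vB wB.
exists (nth 0 [:: v; w - v]), 2; split=> [||t].
- by rewrite curve0.
- by rewrite /curve !big_ord_recl big_ord0 /= !expr1n !scale1r addr0 addrC subrK.
rewrite /curve; set u := \sum_(_ < _) _.
have uB : u \in B.
  by rewrite /u !big_ord_recl big_ord0 /= !(rpredD, rpredZ, rpredN, rpred0).
have [->|nzu] := eqVneq u 0; first by exists x; rewrite ?mem0v ?xv // -memvE.
by exists (line nzu); rewrite /projlin /= -?memvE ?memv_line.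
Qed.

End ProjectiveSets.

(** * Krull dimension of linear sections *)

Section Dimension.
Variables (F : numFieldType) (V : vectType F).
Implicit Types (f g h : polyfun V) (v w : V) (x y z : proj V) (Z : set (proj V)).
Implicit Types (B : {vspace V}).

(* The Hilbert function of [Z] at [d] is at least [n]. *)
Definition indep Z d n := exists2 f : 'I_n -> polyfun V, forall i, f i \is d.-homog &
  forall c : 'I_n -> F, zero_on (\sum_i c i *: f i) Z -> forall i, c i = 0.

Lemma homogeneous_comb d n (c : 'I_n -> F) (f : 'I_n -> polyfun V) :
  (forall i, f i \is d.-homog) -> \sum_i c i *: f i \is d.-homog.
Proof. by move=> hf; apply: rpred_sum => i _; apply: rpredZ. Qed.

Lemma zero_onD f g Z : zero_on f Z -> zero_on g Z -> zero_on (f + g) Z.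
Proof.
move=> f0 g0 x Zx v vx; rewrite /pevalv mevalD -!/(pevalv _ _).
by rewrite (f0 x Zx) // (g0 x Zx) // addr0.
Qed.

Lemma zero_onM f g Z : zero_on f Z -> zero_on (f * g) Z.
Proof. by move=> f0 x Zx v vx; rewrite pevalvM (f0 x Zx) // mul0r. Qed.

Lemma zero_onN f Z : zero_on f Z -> zero_on (- f) Z.
Proof. by move=> f0 x Zx v vx; rewrite /pevalv mevalN -!/(pevalv _ _) (f0 x Zx) // oppr0. Qed.

(** Multiplication by [h] is injective on functions on the irreducible Z1, and its image dies on Z0.
    So the Hilbert function of Z1 in degree e + d is at least its value in degree d plus that of Z0
    in degree e + d. *)
Lemma indep_step Z0 Z1 h d e n0 n1 : irreducible_closed Z1 -> Z0 `<=` Z1 ->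
  h \is e.-homog -> zero_on h Z0 -> ~ zero_on h Z1 ->
  indep Z1 d n1 -> indep Z0 (e + d) n0 -> indep Z1 (e + d) (n1 + n0).
Proof.
move=> irr1 Z01 hh h0 h1 [u hu ui] [w hw wi].
pose f i := match split i with inl j => h * u j | inr j => w j end.
exists f => [i|c].
  by rewrite /f; case: (split i) => j //; apply: dhomogM.
rewrite big_split_ord /=.
under eq_bigr => i _ do rewrite /f (unsplitK (inl i)) scalerAr.
under [X in _ + X]eq_bigr => i _ do rewrite /f (unsplitK (inr i)).
rewrite -mulr_sumr; set U := \sum_i _; set W := \sum_i _ => UW0.
have W0 : zero_on W Z0.
  rewrite -[W](addKr (h * U)) addrC; apply: zero_onD.
    by move=> x /Z01; apply: UW0.
  by apply: zero_onN; apply: zero_onM.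
have cw := wi _ W0.
have {}W0 : W = 0 by rewrite /W big1 // => i _; rewrite cw scale0r.
move: UW0; rewrite W0 addr0.
case/(irreducible_prime irr1); first by exists e.
- by exists d; apply: homogeneous_comb.
- by [].
move=> /ui cu i; rewrite -(splitK i); case: (split i) => j /=.
  exact: cu.
exact: cw.
Qed.

Lemma indep_pow Z l n : l \is 1.-homog -> ~ zero_on l Z -> indep Z n 1.
Proof.
move=> hl l0; exists (fun=> l ^+ n) => [_|c].
  by rewrite -[n in n.-homog]mul1n; apply: dhomogMn.
rewrite big_ord1 => H i; rewrite ord1; apply/eqP/contraT => c0.
case: l0 => x Zx v vx; have /eqP := H x Zx v vx.
rewrite /pevalv mevalZ rmorphXn mulf_eq0 (negPf c0) /= expf_eq0.
by move=> /andP[_ /eqP].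
Qed.

(* Multiplication by [h k] and restriction to [Z k] give the recursion of the
   binomial coefficients, so that a chain of length [k] forces growth of degree [k]. *)
Lemma indep_chain (Z : nat -> set (proj V)) (h : nat -> polyfun V) l e k :
  (forall i, (i <= k)%N -> irreducible_closed (Z i)) ->
  (forall i, (i < k)%N -> Z i `<=` Z i.+1) ->
  (forall i, (i < k)%N ->
     [/\ h i \is e.-homog, zero_on (h i) (Z i) & ~ zero_on (h i) (Z i.+1)]) ->
  l \is 1.-homog -> ~ zero_on l (Z 0%N) ->
  forall n, indep (Z k) (n * e) 'C(n + k, k).
Proof.
elim: k => [|k IHk] irr sub hP hl l0 n.
  by rewrite bin0; apply: indep_pow hl l0.
have {}IHk := IHk (fun i ik => irr i (leqW ik)) (fun i ik => sub i (leqW ik))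
  (fun i ik => hP i (leqW ik)) hl l0.
have [hh h0 h1] := hP k (leqnn _).
elim: n => [|n IHn].
  rewrite add0n binn; apply: indep_pow hl _ => lk; apply: l0 => x Zx; apply: lk.
  have: forall i, (i <= k.+1)%N -> Z i x.
    by elim=> // i IHi ik; apply: sub => //; apply: IHi; apply: ltnW.
  exact.
rewrite mulSn addSn binS.
apply: indep_step (irr _ (leqnn _)) (sub _ (leqnn _)) hh h0 h1 IHn _.
by rewrite -mulSn -addSnnS.
Qed.

(** The points of v + <<bs>> with natural coordinates at most [d]: they suffice to detect a
    polynomial of degree [d] on this affine space. *)
Fixpoint grid v (bs : seq V) d : seq V :=
  if bs is b :: bs' then flatten [seq grid (v + j%:R *: b) bs' d | j <- iota 0 d.+1]
  else [:: v].

Lemma size_grid v bs d : size (grid v bs d) = (d.+1 ^ size bs)%N.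
Proof.
elim: bs v => //= b bs IH v; rewrite size_cat IH size_flatten /shape -map_comp.
rewrite (eq_map (g := fun=> (d.+1 ^ size bs)%N)) => [|j /=]; last by rewrite IH.
rewrite sumnE big_map big_const_seq count_predT size_iota iter_addn_0 expnS mulSn.
by rewrite mulnC.
Qed.

Lemma pevalv_line f d v w : f \is d.-homog ->
  exists2 q : {poly F}, (size q <= d.+1)%N & forall t, q.[t] = pevalv f (v + t *: w).
Proof.
move=> hf; exists (along f (nth 0 [:: v; w]) 2); first exact: size_along_line hf.
by move=> t; rewrite horner_along /curve !big_ord_recl big_ord0 /= expr0 scale1r expr1 addr0.
Qed.

Lemma grid_span f d v bs : f \is d.-homog ->
  (forall u, u \in grid v bs d -> pevalv f u = 0) ->
  forall w, w \in <<bs>>%VS -> pevalv f (v + w) = 0.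
Proof.
move=> hf; elim: bs v => [|b bs IH] v H w.
  by rewrite span_nil memv0 => /eqP ->; rewrite addr0 H //= inE.
rewrite span_cons => /memv_addP[_ /vlineP[a ->] [w' w'bs ->]].
have [q szq qE] := pevalv_line (v + w') b hf.
rewrite addrCA addrA [a *: b + v]addrC addrAC -qE (@poly_eq0_natr _ q) ?horner0 // => n nq.
rewrite qE addrAC; apply: IH => // u uG; apply: H.
apply/flattenP; exists (grid (v + n%:R *: b) bs d) => //.
by apply/mapP; exists n; rewrite // mem_iota /= add0n (leq_trans nq).
Qed.

(** The grid lies in the affine chart where the coefficient of [b] is 1. Homogeneity reaches every
    nonzero coefficient, and the hyperplane at infinity follows because a polynomial in t vanishing
    at nonzero naturals also vanishes at 0. *)
Lemma grid_vspace f d B b bs : f \is d.-homog -> (B <= <[b]> + <<bs>>)%VS ->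
  (forall u, u \in grid b bs d -> pevalv f u = 0) ->
  forall w, w \in B -> pevalv f w = 0.
Proof.
move=> hf /subvP sB H w /sB/memv_addP[_ /vlineP[a ->] [u ubs ->]].
have Hb := grid_span hf H.
have Hnz t : t != 0 -> pevalv f (t *: b + u) = 0.
  move=> t0; rewrite -[u](scalerKV t0) -scalerDr (pevalv_homog _ _ hf) Hb ?mulr0 //.
  by rewrite rpredZ.
have [->|/Hnz//] := eqVneq a 0; rewrite scale0r add0r.
have [q _ qE] := pevalv_line u b hf.
suff /eqP : q * 'X = 0.
  rewrite mulf_eq0 polyX_eq0 orbF => /eqP q0.
  by rewrite -[u]addr0 -(scale0r b) -qE q0 horner0.
apply: poly_eq0_natr => n _; rewrite hornerM hornerX.
have [->|n0] := eqVneq (n%:R : F) 0; first by rewrite mulr0.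
by rewrite qE addrC Hnz // mul0r.
Qed.

(** More forms than grid points would have a nontrivial combination vanishing on the grid, hence on
    [B]. The bound is cruder than the binomial value of the Hilbert function but has the same degree
    in [d], which is all that [bin_growth] asks for. *)
Lemma indep_projlin B d n : B != 0%VS -> indep (projlin B) d n ->
  (n <= d.+1 ^ (\dim B).-1)%N.
Proof.
move=> nzB [f hf fi]; rewrite leqNgt; apply/negP => lt_n.
have : size (vbasis B) = \dim B by rewrite size_tuple.
case E : (val (vbasis B)) => [|b bs] /= szB.
  by move: nzB; rewrite -dimv_eq0 -szB eqxx.
pose G := grid b bs d; pose M := \matrix_(i < n, j < size G) pevalv (f i) G`_j.
have: kermx M != 0.
  rewrite -mxrank_eq0 mxrank_ker subn_eq0 -ltnNge.
  by apply: leq_ltn_trans (rank_leq_col _) _; rewrite size_grid -[size bs]/(size bs).+1.-1 szB.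
case/rowV0Pn => c /sub_kermxP cM /eqP; case; apply/rowP => i; rewrite mxE.
apply: fi i => x xB v vx.
apply: (@grid_vspace _ d B b bs); last exact: (subvP xB).
- exact: homogeneous_comb.
- by rewrite -span_cons -E (span_basis (vbasisP B)).
move=> u uG; rewrite -(nth_index 0 uG).
have uG' : (index u G < size G)%N by rewrite index_mem.
have := congr1 (fun A : 'rV_(size G) => A 0 (Ordinal uG')) cM; rewrite !mxE /= => cM0.
rewrite pevalv_lin -[RHS]cM0; apply: eq_bigr => i _; rewrite mxE //.
Qed.

Lemma chain_projlin B k : irr_chain (projlin B) k -> (k < \dim B)%N.
Proof.
move=> [Z [irrZ ltZ]].
pose Zn i := Z (inord i : 'I_k.+1).
have [_ [x0 Z0x] _] := (irrZ ord0).1.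
have [v0 nz0 xv0] := proj_gen x0.
have nzB : B != 0%VS.
  apply/eqP => B0; have := (irrZ ord0).2 _ Z0x.
  by rewrite /projlin /= B0 xv0 -memvE memv0 (negPf nz0).
have v00 : v0 \notin (0%VS : {vspace V}) by rewrite memv0.
(* A linear form that is nonzero at a point of the smallest member of the chain, hence vanishes
   identically on no member. *)
have [L _ Lv0] := vspace_functional v00.
pose l := linform L.
have hl : l \is 1.-homog := linform_homog L.
have l0 : ~ zero_on l (Zn 0%N).
  have Z0x' : Zn 0%N x0 
    by rewrite /Zn (_ : inord 0 = ord0) //; apply/val_inj; rewrite /= inordK.
  move=> /(_ _ Z0x' v0); rewrite xv0 memv_line pevalv_linform => /(_ isT)/eqP.
  by rewrite (negPf Lv0).
have irrZn i : irreducible_closed (Zn i) := (irrZ _).1.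
have ltZn i : (i < k)%N -> Zn i `<` Zn i.+1.
  by move=> ik; apply: ltZ; rewrite !inordK // ltnS // ltnW.
have lZn i : (i <= k)%N -> ~ zero_on l (Zn i).
  elim: i => // i IH ik H; apply: IH (ltnW ik) _ => x Zx.
  by apply: H; exact: (ltZn i ik).1.
have /choice[g gP] : forall i, exists g : polyfun V * nat, (i < k)%N ->
    [/\ g.1 \is g.2.-homog, zero_on g.1 (Zn i) & ~ zero_on g.1 (Zn i.+1)].
  move=> i; have [ik|] := ltnP i k; last by exists (0, 0%N).
  have [_ /nonsubset[x [Zx nZx]]] := ltZn i ik.
  have [clZ _ _] := irrZn i.
  have [f [[d hf] f0 fx]] := closed_separate clZ nZx.
  by exists (f, d) => _; split=> // /(_ x Zx).
(* The separating forms have different degrees; powers of [l] bring them all to the common degree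
   [e] without making them vanish on the larger member. *)
pose e := (\max_(i < k) (g i).2)%N.
pose h i := (g i).1 * l ^+ (e - (g i).2).
have hP i : (i < k)%N ->
    [/\ h i \is e.-homog, zero_on (h i) (Zn i) & ~ zero_on (h i) (Zn i.+1)].
  move=> ik; have [hg g0 g1] := gP i ik.
  have hle : l ^+ (e - (g i).2) \is (e - (g i).2).-homog.
    by rewrite -[X in X.-homog]mul1n; apply: dhomogMn.
  split; last 1 first.
  - case/(irreducible_prime (irrZn i.+1)) => //; [by exists (g i).2|by eexists; exact: hle|].
    move=> H; apply: (lZn i.+1 ik) => x Zx v vx; apply/eqP.
    have /eqP := H x Zx v vx; rewrite pevalvX expf_eq0.
    by case/andP.
  - have le_e : ((g i).2 <= e)%N by apply: (leq_bigmax (Ordinal ik)).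
    by rewrite -[X in X.-homog](subnKC le_e); apply: dhomogM.
  - exact: zero_onM.
have H n := indep_chain (fun i _ => irrZn i) (fun i ik => (properW (ltZn i ik))) hP hl l0 n.
have dB : (0 < \dim B)%N by rewrite lt0n dimv_eq0.
rewrite -(prednK dB) ltnS; apply: (@bin_growth _ _ e) => n.
apply: indep_projlin nzB _.
have [f hf fi] := H n; exists f => // c c0; apply: fi => x Zx; apply: c0.
exact: (irrZ _).2 _ Zx.
Qed.

End Dimension.

(** * Unions of two linear spaces: dimension, components, smoothness *)

Section LinearSections.
Variables (F : numFieldType) (V : vectType F).
Implicit Types (f g h : polyfun V) (v w : V) (x y z : proj V) (Z X : set (proj V)).
Implicit Types (B C : {vspace V}).

Lemma irr_chain_sub X X' d : X `<=` X' -> irr_chain X d -> irr_chain X' d.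
Proof.
move=> XX' [Z [irrZ ltZ]]; exists Z; split=> // i.
by split; [exact: (irrZ i).1|apply: subset_trans (irrZ i).2 XX'].
Qed.

Lemma projlin_chain B : B != 0%VS -> irr_chain (projlin B) (\dim B).-1.
Proof.
move=> nzB; have dB : (0 < \dim B)%N by rewrite lt0n dimv_eq0.
have szB : size (vbasis B) = \dim B by rewrite size_tuple.
pose S i := <<take i.+1 (vbasis B)>>%VS.
have dS i : (i < \dim B)%N -> \dim (S i) = i.+1.
  move=> iB; rewrite /S (eqnP (_ : free _)) ?size_takel ?szB //.
  have := basis_free (vbasisP B); rewrite -{1}(cat_take_drop i.+1 (vbasis B)).
  exact: catl_free.
have sub i j : (i <= j)%N -> (S i <= S j)%VS.
  move=> ij; apply: sub_span => v; rewrite -(subnKC ij) -addSn takeD mem_cat => ->.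
  by [].
exists (fun i : 'I_(\dim B).-1.+1 => projlin (S i)); split=> [i|i j ij].
  have iB : (i < \dim B)%N by rewrite -[X in (_ < X)%N](prednK dB).
  split; first by apply: irreducible_projlin; rewrite -dimv_eq0 dS.
  move=> x; rewrite /projlin /= => /subv_trans; apply; apply/span_subvP => v /mem_take.
  exact: vbasis_mem.
have jB : (j < \dim B)%N by rewrite -[X in (_ < X)%N](prednK dB).
split=> [x|H]; first by move=> /= /subv_trans; apply; apply/sub/ltnW.
have : ~~ (S j <= S i)%VS.
  apply/negP => /dimvS; rewrite !dS ?(ltn_trans ij) // ltnS.
  by rewrite leqNgt ij.
case/subvPn => v vj vi.
have nz : v != 0 by apply: contraNneq vi => ->; rewrite mem0v.
move: vi; rewrite memvE; move/negP; apply; apply: (H (line nz)).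
by rewrite /projlin /= -memvE.
Qed.

Lemma has_dim_projlin B : B != 0%VS -> has_dim (projlin B) (\dim B).-1.
Proof.
move=> nzB; split; first exact: projlin_chain.
by move=> e /chain_projlin lt; rewrite -ltnS prednK ?lt0n ?dimv_eq0.
Qed.

(** A chain lives inside its largest member. That member is irreducible, so in a union of two closed
    sets the whole chain lies in one of them. *)
Lemma chain_top X k : irr_chain X k -> exists2 Z, irreducible_closed Z /\ Z `<=` X &
  irr_chain Z k.
Proof.
move=> [Z [irrZ ltZ]]; exists (Z ord_max); first exact: irrZ.
exists Z; split=> // i; split; first exact: (irrZ i).1.
have [->//|ni] := eqVneq i ord_max.
apply: (ltZ _ _ _).1; rewrite ltn_neqAle -ltnS ltn_ord andbT.
by apply: contra ni => /eqP H; apply/eqP/val_inj.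
Qed.

Lemma irreducible_in_union B C Z : irreducible_closed Z ->
  Z `<=` projlin B `|` projlin C -> Z `<=` projlin B \/ Z `<=` projlin C.
Proof. by move=> [_ _ H]; apply: H; apply: proj_closed_projlin. Qed.

Lemma projlin_nonempty B Z : Z !=set0 -> Z `<=` projlin B -> B != 0%VS.
Proof.
move=> [x /[swap]/[apply]]; have [v nz xv] := proj_gen x; rewrite /projlin /= xv -memvE.
by apply: contraTneq => ->; rewrite memv0.
Qed.

Lemma has_dim_union B C : (B != 0)%VS || (C != 0)%VS ->
  has_dim (projlin B `|` projlin C) (maxn (\dim B) (\dim C)).-1.
Proof.
wlog le : B C / (\dim C <= \dim B)%N.
  move=> H; case/orP: (leq_total (\dim C) (\dim B)) => /H //.
  by rewrite [_ `|` _]setUC maxnC orbC.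
rewrite (maxn_idPl le) => nz.
have nzB : B != 0%VS.
  case/orP: nz => //; rewrite -!dimv_eq0 -!lt0n => dC; apply: leq_trans dC le.
split; first by apply: irr_chain_sub (projlin_chain nzB) => x; left.
have dB : (0 < \dim B)%N by rewrite lt0n dimv_eq0.
move=> e /chain_top[Z [irrZ ZX] ch]; rewrite -ltnS prednK //.
have [sub|sub] := irreducible_in_union irrZ ZX.
  exact: chain_projlin (irr_chain_sub sub ch).
exact: leq_trans (chain_projlin (irr_chain_sub sub ch)) le.
Qed.

Lemma component_union B C Z : irr_component Z (projlin B `|` projlin C) ->
  exists2 D, D != 0%VS & Z = projlin D.
Proof.
move=> [irrZ ZX maxZ].
have [_ neZ _] := irrZ.
have [sub|sub] := irreducible_in_union irrZ ZX;
    have nz := projlin_nonempty neZ sub; have irr := irreducible_projlin nz.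
  by exists B => //; apply/esym/maxZ => // x; left.
by exists C => //; apply/esym/maxZ => // x; right.
Qed.

(** The coefficients [c 0] and [c 1] are the position and the velocity of the curve at parameter
    0. *)
Lemma tangent_curve f (c : nat -> V) k : (1 < k)%N ->
  (forall t, pevalv f (curve c k t) = 0) -> pdiff f (c 0%N) (c 1%N) = 0.
Proof.
move=> k1 H; rewrite (pdiff_along f c k1) (_ : along f c k = 0) ?deriv0 ?horner0 //.
by apply: poly_eq0_natr => n _; rewrite horner_along.
Qed.

Lemma smooth_projlin B : B != 0%VS -> smooth (projlin B).
Proof.
move=> nzB; exists (\dim B).-1; first exact: has_dim_projlin.
move=> x xB; exists B; last by rewrite prednK ?lt0n ?dimv_eq0.
have {}xB : (val x <= B)%VS by [].
apply/seteqP; split=> w /=.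
  move=> wB f hf f0 v vx nz.
  apply: (@tangent_curve f (nth 0 [:: v; w]) 2) => // t.
  rewrite /curve !big_ord_recl big_ord0 /= expr0 scale1r expr1 addr0.
  set u := v + _; have uB : u \in B.
    by rewrite rpredD ?rpredZ //; apply: (subvP xB).
  have [u0|nzu] := eqVneq u 0.
    by apply: (f0 x xB); rewrite u0 mem0v.
  by apply: (f0 (line nzu)); rewrite /projlin /= -?memvE ?memv_line.
move=> H; apply: contraT => /vspace_functional[L LB].
have [v nz xv] := proj_gen x.
rewrite -(pdiff_linform L v w) (H (linform L)) ?eqxx //.
- by exists 1%N; apply: linform_homog.
- by move=> y yB u uy; rewrite pevalv_linform LB // (subvP yB).
- by rewrite xv memv_line.
Qed.

End LinearSections.

(** * Conics *)

Section Conic.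
Variables (F : numFieldType) (V : vectType F).
Implicit Types (f g h : polyfun V) (v w : V) (x y z : proj V) (Z X : set (proj V)).

Lemma chain_extend X Z X' k : irr_chain X k -> irreducible_closed Z ->
  X `<` Z -> Z `<=` X' -> irr_chain X' k.+1.
Proof.
move=> [C [irrC ltC]] irrZ [XZ ZX] ZX'.
exists (fun i : 'I_k.+2 => if (i < k.+1)%N then C (inord i) else Z); split=> [i|i j ij].
  case: ifP => _ //; split; first exact: (irrC _).1.
  by apply: subset_trans ZX'; apply: subset_trans XZ; exact: (irrC _).2.
have ik : (i < k.+1)%N by apply: leq_trans ij _; rewrite -ltnS.
rewrite ik; case: ifP => jk; first by apply: ltC; rewrite !inordK.
have sub := (irrC (inord i)).2.
split; first exact: subset_trans sub XZ.
by move=> H; apply: ZX; apply: subset_trans H sub.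
Qed.

Lemma vlineZ k v : k != 0 -> <[k *: v]>%VS = <[v]>%VS.
Proof.
move=> k0; apply/eqP; rewrite eqEsubv -!memvE memvZ ?memv_line //=.
by rewrite -[v in v \in _](scalerK k0) memvZ ?memv_line.
Qed.

Variable Y : 3.-tuple V.
Hypothesis freeY : free Y.

Definition lin3 a b c : V := a *: Y`_0 + b *: Y`_1 + c *: Y`_2.

(** The degree two Veronese map, parametrizing the conic a c = b^2 in the plane spanned by [Y]. *)
Definition veronese s t : V := lin3 (s ^+ 2) (s * t) (t ^+ 2).

Definition conic : set (proj V) := [set x | exists s t, val x = <[veronese s t]>%VS].

Lemma lin3D a b c a' b' c' :
  lin3 a b c + lin3 a' b' c' = lin3 (a + a') (b + b') (c + c').
Proof. by rewrite /lin3 !scalerDl addrACA; congr (_ + _); rewrite addrACA. Qed.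

Lemma lin3Z k a b c : k *: lin3 a b c = lin3 (k * a) (k * b) (k * c).
Proof. by rewrite /lin3 !scalerDr !scalerA. Qed.

Lemma lin3_sum a b c : lin3 a b c = \sum_(i < 3) [:: a; b; c]`_i *: Y`_i.
Proof. by rewrite !big_ord_recl big_ord0 /= addr0 /lin3 addrA. Qed.

Let L (i : 'I_3) : {scalar V} := coord Y i.

Lemma coord_lin3 (i : 'I_3) a b c : coord Y i (lin3 a b c) = [:: a; b; c]`_i.
Proof. by rewrite lin3_sum (coord_sum_free (fun i : 'I_3 => [:: a; b; c]`_i)). Qed.

Lemma span_lin3 v : v \in <<Y>>%VS ->
  v = lin3 (coord Y 0 v) (coord Y 1 v) (coord Y 2%:R v).
Proof.
move=> vY; rewrite [LHS](coord_span vY) !big_ord_recl big_ord0 addr0 /lin3 addrA.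
by congr (_ *: _ + _ *: _ + _ *: _); congr (coord Y _ v); apply/val_inj.
Qed.

Lemma lin3_span a b c : lin3 a b c \in <<Y>>%VS.
Proof.
by rewrite /lin3 !rpredD ?rpredZ ?memv_span ?mem_nth ?size_tuple.
Qed.

Lemma lin3_eq0 a b c : lin3 a b c = 0 -> [/\ a = 0, b = 0 & c = 0].
Proof.
move=> H; split.
- by rewrite -[LHS]/([:: a; b; c]`_(0%R : 'I_3)) -coord_lin3 H linear0.
- by rewrite -[LHS]/([:: a; b; c]`_(1%R : 'I_3)) -coord_lin3 H linear0.
- by rewrite -[LHS]/([:: a; b; c]`_(2%:R%R : 'I_3)) -coord_lin3 H linear0.
Qed.

Definition conic_form : polyfun V :=
  linform (L 0) * linform (L 2%:R) - linform (L 1) ^+ 2.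

Lemma conic_form_homog : homogeneous conic_form.
Proof.
exists 2%N; apply: rpredB; last by apply: (dhomogMn 2 (linform_homog _)).
exact: (dhomogM (linform_homog _) (linform_homog _)).
Qed.

Lemma pevalv_conic_form v :
  pevalv conic_form v = coord Y 0 v * coord Y 2%:R v - coord Y 1 v ^+ 2.
Proof.
rewrite /conic_form /pevalv mevalB -!/(pevalv _ _) pevalvM pevalvX.
by rewrite !pevalv_linform.
Qed.

Lemma veronese_eq0 s t : veronese s t = 0 -> s = 0 /\ t = 0.
Proof. by case/lin3_eq0 => /eqP + _ /eqP; rewrite !expf_eq0 => /eqP -> /eqP ->. Qed.

(** The parametrization is inverted without square roots: if a c = b^2 and a is nonzero, then a (a,
    b, c) is the image of (a, b); if a = 0 then b = 0, and the point is the image of (0, 1). *)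
Lemma conicE : conic = projlin <<Y>> `&` [set x | vanishes_at conic_form x].
Proof.
apply/seteqP; split=> x /=.
  move=> [s [t xst]]; split.
    by rewrite /projlin /= xst -memvE lin3_span.
  apply/(vanishes_gen conic_form_homog xst); rewrite pevalv_conic_form !coord_lin3 /=.
  ring.
have [v nz xv] := proj_gen x; rewrite /projlin /= xv -memvE.
move=> [/span_lin3 + /(vanishes_gen conic_form_homog xv)].
rewrite pevalv_conic_form; move: (coord Y 0 v) (coord Y 1 v) (coord Y 2%:R v) => a b c.
move=> vE /eqP; rewrite subr_eq0 => /eqP acb.
have [a0|a0] := eqVneq a 0.
  have b0 : b = 0 by apply/eqP; rewrite -sqrf_eq0 -acb a0 mul0r.
  exists 0, 1; rewrite xv.
  have c0 : c != 0.
    by apply: contraNneq nz => c0; rewrite vE a0 b0 c0 /lin3 !scale0r !addr0.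
  rewrite vE a0 b0 (_ : lin3 0 0 c = c *: veronese 0 1) ?vlineZ //.
  by rewrite lin3Z; congr lin3; ring.
exists a, b; rewrite xv (_ : veronese a b = a *: v) ?vlineZ //.
by rewrite vE lin3Z acb; congr lin3; ring.
Qed.

Lemma proj_closed_conic : proj_closed conic.
Proof.
rewrite conicE; apply: proj_closedI; first exact: proj_closed_projlin.
exact: proj_closed_zeros conic_form_homog.
Qed.

(* The expansion of [veronese (s + r * a) (t + r * b)] in powers of [r]. *)
Definition veronese_curve k s t a b : nat -> V :=
  nth 0 [:: k *: veronese s t; k *: lin3 (2 * s * a) (t * a + s * b) (2 * t * b);
            k *: veronese a b].

Lemma veronese_curveE k s t a b r :
  curve (veronese_curve k s t a b) 3 r = k *: veronese (s + r * a) (t + r * b).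
Proof.
rewrite /curve /veronese_curve !big_ord_recl big_ord0 addr0 /= /veronese !lin3Z !lin3D.
by congr lin3; ring.
Qed.

Lemma conic_veronese s t : veronese s t != 0 ->
  exists2 x, conic x & val x = <[veronese s t]>%VS.
Proof. by move=> nz; exists (line nz) => //; exists s, t. Qed.

Lemma conic_curve x k s t : conic x -> exists2 y, conic y & k *: veronese s t \in val y.
Proof.
move=> xC; have [->|nz] := eqVneq (veronese s t) 0.
  by exists x; rewrite // scaler0 mem0v.
by have [y yC yE] := conic_veronese nz; exists y; rewrite // yE rpredZ ?memv_line.
Qed.

Lemma irreducible_conic : irreducible_closed conic.
Proof.
apply: curve_connected_irreducible; first exact: proj_closed_conic.
  have nz : veronese 1 0 != 0.
    by apply/eqP => /veronese_eq0[/eqP]; rewrite oner_eq0.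
  by have [x xC _] := conic_veronese nz; exists x.
move=> x y xC [s1 [t1 yE]]; have [s0 [t0 xE]] := xC.
(* The image of the segment joining the parameters. The segment may meet (0, 0), where the curve is
   the zero vector; [conic_curve] covers this. *)
exists (veronese_curve 1 s0 t0 (s1 - s0) (t1 - t0)), 3; split.
- by rewrite veronese_curveE scale1r !mul0r !addr0.
- by rewrite veronese_curveE scale1r !mul1r ![s0 + _]addrC ![t0 + _]addrC !subrK.
by move=> t; rewrite veronese_curveE; apply: conic_curve xC.
Qed.

Lemma zero_on_conic f k s t : zero_on f conic -> pevalv f (k *: veronese s t) = 0.
Proof.
move=> f0; have [_ [x xC] _] := irreducible_conic.
by have [y /f0] := conic_curve k s t xC; apply.
Qed.

Lemma mem_conic a b c (nz : lin3 a b c != 0) : conic (line nz) <-> a * c = b ^+ 2.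
Proof.
rewrite conicE /= (@vanishes_gen _ _ conic_form _ (lin3 a b c)) //; last first.
  exact: conic_form_homog.
rewrite pevalv_conic_form !coord_lin3 /=; split=> [[_ /eqP]|->].
  by rewrite subr_eq0 => /eqP.
by rewrite subrr; split=> //; rewrite /projlin /= -memvE lin3_span.
Qed.

Lemma lin3_neq0 a b c : [|| a != 0, b != 0 | c != 0] -> lin3 a b c != 0.
Proof. by apply: contraTneq => /lin3_eq0[-> -> ->]; rewrite eqxx. Qed.

Lemma has_dim_conic : has_dim conic 1.
Proof.
have dimY : \dim <<Y>> = 3 by rewrite (eqnP freeY) size_tuple.
have nz1 : lin3 1 0 0 != 0 by rewrite lin3_neq0 ?oner_eq0.
have nz2 : lin3 0 1 0 != 0 by rewrite lin3_neq0 ?oner_eq0 ?orbT.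
have nz3 : lin3 0 0 1 != 0 by rewrite lin3_neq0 ?oner_eq0 ?orbT.
split.
  apply: (@chain_extend (projlin <[lin3 1 0 0]>) conic); last by [].
  - have := @projlin_chain _ _ <[lin3 1 0 0]>%VS; rewrite dim_vline nz1; apply.
    by rewrite -dimv_eq0 dim_vline nz1.
  - exact: irreducible_conic.
  split=> [x|H].
    rewrite /projlin /= => xl; rewrite conicE.
    have xE : val x = <[lin3 1 0 0]>%VS.
      by apply/eqP; rewrite eqEdim xl dim_vline nz1; case: x {xl} => S /= /eqP ->.
    split; first by rewrite /projlin /= xE -memvE lin3_span.
    apply/(vanishes_gen conic_form_homog xE); rewrite pevalv_conic_form !coord_lin3 /=.
    by ring.
  have : projlin <[lin3 1 0 0]> (line nz3).
    by apply: H; apply/mem_conic; ring.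
  rewrite /projlin /= -memvE => /vlineP[k]; rewrite lin3Z => /eqP; rewrite -subr_eq0.
  rewrite -scaleN1r lin3Z lin3D => /eqP/lin3_eq0[_ _ /eqP].
  by rewrite !mulr0 addr0 oner_eq0.
move=> e ch.
(* A chain in the conic continued by the plane itself is a chain in the plane, so e + 1 < 3. *)
suff : irr_chain (projlin <<Y>>) e.+1 by move=> /chain_projlin; rewrite dimY.
apply: (@chain_extend conic (projlin <<Y>>) _ _ ch) => //.
  by apply: irreducible_projlin; rewrite -dimv_eq0 dimY.
split; first by rewrite conicE => x [].
move=> sub; have /mem_conic/eqP : conic (line nz2).
  by apply: sub; rewrite /projlin /= -memvE lin3_span.
by rewrite mul0r expr1n eq_sym oner_eq0.
Qed.

Lemma smooth_conic : smooth conic.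
Proof.
exists 1%N; first exact: has_dim_conic.
move=> x xC; have [s [t xE]] := xC.
have nzv : veronese s t != 0.
  by case: x xE {xC} => S /= /eqP dS SE; move: dS; rewrite SE dim_vline; case: eqP.
have nzst : (s != 0) || (t != 0).
  by apply: contraNT nzv; rewrite negb_or !negbK => /andP[/eqP-> /eqP->];
     rewrite /veronese /lin3 mul0r expr0n /= !scale0r !addr0.
have two0 : (2 : F) != 0 by rewrite pnatr_eq0.
(* The partial derivatives of [veronese] in s and t. *)
pose u := lin3 (2 * s) t 0; pose w := lin3 0 s (2 * t).
exists <<[:: u; w]>>%VS; last first.
  suff /eqnP -> : free [:: u; w] by [].
  rewrite free_cons seq1_free span_seq1; apply/andP; split; last first.
    by apply: lin3_neq0; rewrite mulf_eq0 (negPf two0) eqxx.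
  apply: contraL nzst => /vlineP[k /eqP]; rewrite -subr_eq0 /u /w -scaleN1r !lin3Z lin3D.
  move=> /eqP/lin3_eq0[/eqP + /eqP]; rewrite !mulr0 addr0 mulf_eq0 (negPf two0) /= => /eqP ->.
  by rewrite !mulr0 addr0 => /eqP -> _; rewrite eqxx.
apply/seteqP; split=> z /=.
  rewrite span_cons span_seq1 => /memv_addP[_ /vlineP[a ->] [_ /vlineP[b ->] ->]].
  move=> f hf f0 v; rewrite xE => /vlineP[k ->] nz.
  have k0 : k != 0 by apply: contraNneq nz => ->; rewrite scale0r.
  (* The curve starts at the given generator [k *: veronese s t], so the direction in the parameters
     is divided by [k]. *)
  rewrite (_ : a *: u + b *: w = veronese_curve k s t (a / k) (b / k) 1%N); last first.
    by rewrite /veronese_curve /= /u /w !lin3Z lin3D; congr lin3; field.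
  apply: (@tangent_curve _ _ f (veronese_curve k s t (a / k) (b / k)) 3) => // r.
  by rewrite veronese_curveE; apply: zero_on_conic.
move=> H; have zY : z \in <<Y>>%VS.
  apply: contraT => /vspace_functional[M MY].
  rewrite -(pdiff_linform M (veronese s t) z) (H (linform M)) ?eqxx //.
  - by exists 1%N; apply: linform_homog.
  - move=> y [s' [t' yE]] v; rewrite yE pevalv_linform => /vlineP[k ->].
    by rewrite linearZ /= MY ?lin3_span // mulr0.
  - by rewrite xE memv_line.
have := H conic_form conic_form_homog _ (veronese s t) _ nzv.
rewrite xE memv_line => /(_ _ isT).
rewrite /conic_form pdiffB expr2 !pdiffM !pdiff_linform !pevalv_linform /L /=.
rewrite /veronese !coord_lin3 /=.
move=> Hz; have {}Hz : coord Y 0 z * t ^+ 2 + s ^+ 2 * coord Y 2%:R z -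
    (coord Y 1 z * (s * t) + s * t * coord Y 1 z) = 0.
  by apply: Hz; rewrite conicE => y [].
rewrite span_cons span_seq1; apply/memv_addP.
rewrite (span_lin3 zY).
move: (coord Y 0 z) (coord Y 1 z) (coord Y 2%:R z) Hz => z0 z1 z2 Hz.
(* [Hz] is the differential of the conic equation at [veronese s t]; its solutions are expressed in
   [u] and [w] by dividing by s, or by t when s = 0. *)
suff [a [b [<- <- <-]]] : exists a b, [/\ a * (2 * s) = z0, a * t + b * s = z1
     & b * (2 * t) = z2].
  exists (a *: u); first by rewrite memvZ ?memv_line.
  exists (b *: w); first by rewrite memvZ ?memv_line.
  by rewrite !lin3Z lin3D; congr lin3; ring.
have [s0|s0] := eqVneq s 0.
  have t0 : t != 0 by move: nzst; rewrite s0 eqxx.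
  have {}Hz : z0 = 0.
    move: Hz; rewrite s0 => /eqP; rewrite expr0n !mul0r !mulr0 !addr0 oppr0 addr0.
    by rewrite mulf_eq0 sqrf_eq0 (negPf t0) orbF => /eqP.
  exists (z1 / t), (z2 / (2 * t)); split; rewrite ?s0 ?Hz; field; rewrite ?t0 //.
exists (z0 / (2 * s)), ((z1 - z0 / (2 * s) * t) / s); split; try (field; rewrite ?s0 //).
apply/eqP; rewrite -subr_eq0 -(mulrI_eq0 _ (mulfI (expf_neq0 2 s0))) -oppr_eq0.
rewrite -[X in _ == X]Hz; apply/eqP; field; rewrite s0 //.
Qed.

End Conic.

(** * One-parameter subgroups *)

Section Stability.
Variables (F : numFieldType) (V : vectType F).

Lemma det_weights n (w : 'I_n -> int) (t : F) : t != 0 -> \sum_i w i = 0 ->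
  \det (diag_mx (\row_i t ^ w i)) = 1.
Proof.
move=> t0 w0; rewrite det_diag; under eq_bigr => i _ do rewrite mxE.
have expD (a b : int) : t ^ (a + b) = t ^ a * t ^ b by rewrite expfzDr.
by rewrite -(big_morph (fun z : int => t ^ z) expD (expr0z t)) w0 expr0z.
Qed.

(** The component of weight [k] under congruence by diag(t^w). Natural weights suffice because the
    negative components vanish where this is applied. *)
Definition weight_part n (w : 'I_n -> int) (k : nat) (M : 'M[F]_n) : 'M[F]_n :=
  \matrix_(i, j) if w i + w j == k then M i j else 0.

Lemma weight_part_linear n (w : 'I_n -> int) k : linear (weight_part w k).
Proof.
move=> a M M'; apply/matrixP => i j; rewrite !mxE.
by case: ifP => _; rewrite ?mulr0 ?addr0.
Qed.

Lemma diag_congr n (w : 'I_n -> int) (t : F) (M : 'M[F]_n) i j : t != 0 ->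
  (diag_mx (\row_k t ^ w k) *m M *m (diag_mx (\row_k t ^ w k))^T) i j =
  t ^ (w i + w j) * M i j.
Proof.
move=> t0; rewrite tr_diag_mx mul_mx_diag mul_diag_mx !mxE expfzDr //.
by rewrite mulrAC.
Qed.

(* Hilbert-Mumford: the one-parameter subgroup with weights [w] has a limit on
   [phi]; a closed orbit contains it, and the subgroup fixes the limit. *)
Lemma destabilize (phi : 'Hom(V, 'M[F]_6)) (g : 'M[F]_6) (w : 'I_6 -> int) i0 :
  g \in unitmx -> \sum_i w i = 0 -> w i0 = 1 ->
  (forall x i j, w i + w j < 0 -> (g *m phi x *m g^T) i j = 0) ->
  zariski_closed (SL_orbit phi) -> ~ finite_set (SL_stabilizer phi).
Proof.
move=> gu w0 w1 neg [P PE] fin.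
pose gi := invmx g.
pose f k x := gi *m weight_part w k (g *m phi x *m g^T) *m gi^T.
have lin k : linear (f k).
  move=> a x y; rewrite /f linearP mulmxDr mulmxDl -scalemxAr -scalemxAl.
  by rewrite weight_part_linear mulmxDr mulmxDl -scalemxAr -scalemxAl.
pose fL k : {linear V -> 'M[F]_6} := HB.pack (f k) (GRing.isLinear.Build _ _ _ _ _ (lin k)).
pose psi k : 'Hom(V, 'M[F]_6) := linfun (fL k).
have psiE k x : psi k x = f k x by rewrite /psi lfunE.
(* Exceeds every weight, so the orbit under the subgroup [c] is a polynomial curve with the
   coefficients [psi k], k < K, and limit [psi 0] at t = 0. *)
pose K := (\sum_(i < 6) \sum_(j < 6) absz (w i + w j)%R).+1.
have KP i j : (absz (w i + w j)%R < K)%N.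
  rewrite ltnS (bigD1 i) //= (bigD1 j) //= -addnA; exact: leq_addr.
pose D (t : F) := diag_mx (\row_i t ^ w i).
pose c t := gi *m D t *m g.
have gig : gi *m g = 1%:M by apply: mulVmx.
have ggi : g *m gi = 1%:M by apply: mulmxV.
have detc t : t != 0 -> \det (c t) = 1.
  move=> t0; rewrite /c !det_mulmx det_weights // mulr1 -det_mulmx gig.
  exact: det1.
have cM t M : c t *m M *m (c t)^T = gi *m (D t *m (g *m M *m g^T) *m (D t)^T) *m gi^T.
  by rewrite /c !trmx_mul !mulmxA.
have curveE t x : t != 0 -> curve psi K t x = c t *m phi x *m (c t)^T.
  move=> t0; rewrite cM /curve sum_lfunE.
  have -> : D t *m (g *m phi x *m g^T) *m (D t)^T =
      \sum_(k < K) t ^+ k *: weight_part w k (g *m phi x *m g^T).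
    apply/matrixP => i j; rewrite diag_congr // summxE.
    have := neg x i j; move: (g *m phi x *m g^T) => M {}neg.
    under eq_bigr => k _ do rewrite !mxE.
    have [ge0|/neg ->] := leP 0 (w i + w j); last first.
      by rewrite mulr0 big1 // => k _; case: ifP; rewrite mulr0.
    have [m mE] : exists m : nat, w i + w j = m.
      by exists (absz (w i + w j)%R); rewrite gez0_abs.
    have mK : (m < K)%N by have := KP i j; rewrite mE.
    rewrite mE (bigD1 (Ordinal mK)) //= eqxx big1 ?addr0 // => k nk.
    case: ifP => [/eqP[mk]|]; last by rewrite mulr0.
    by case/eqP: nk; apply/val_inj.
  rewrite mulmx_sumr mulmx_suml; apply: eq_bigr => k _.
  by rewrite scale_lfunE psiE /f -scalemxAr -scalemxAl.
have orb t : t != 0 -> SL_orbit phi (curve psi K t).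
  by move=> t0; exists (c t); [exact: detc|move=> x; exact: curveE].
(* Each equation of the closed orbit vanishes on the curve at nonzero t, hence also at t = 0. *)
have : SL_orbit phi (psi 0%N).
  rewrite PE /= => p Pp; rewrite -(@curve0 _ _ psi K) // -horner_along.
  suff /eqP : along p psi K * 'X = 0.
    by rewrite mulf_eq0 polyX_eq0 orbF => /eqP ->; rewrite horner0.
  apply: poly_eq0_natr => n _; rewrite hornerM hornerX.
  have [->|n0] := eqVneq (n%:R : F) 0; first by rewrite mulr0.
  by rewrite horner_along; move: (orb _ n0); rewrite PE /= => ->; rewrite ?mul0r.
move=> [h deth hE].
have hu : h \in unitmx by rewrite unitmxE deth unitr1.
pose hi := invmx h.
have hih : hi *m h = 1%:M by apply: mulVmx.
have hhi : h *m hi = 1%:M by apply: mulmxV.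
have cfix t x : t != 0 -> c t *m psi 0%N x *m (c t)^T = psi 0%N x.
  move=> t0; rewrite cM psiE /f; set M := weight_part _ _ _.
  have -> : g *m (gi *m M *m gi^T) *m g^T = M.
    by rewrite !mulmxA ggi mul1mx -mulmxA -trmx_mul ggi trmx1 mulmx1.
  congr (_ *m _ *m _).
  apply/matrixP => i j; rewrite diag_congr // !mxE.
  by case: ifP => [/eqP->|_]; rewrite ?mulr0 // expr0z mul1r.
(* Since [h] carries [phi] to the limit, conjugation by [h] carries the subgroup fixing the limit
   into the stabilizer of [phi]. The diagonal entry of weight one at [i0] tells the parameters n + 1
   apart. *)
pose s (n : nat) := hi *m c n.+1%:R *m h.
have nz (n : nat) : n.+1%:R != 0 :> F by rewrite pnatr_eq0.
have stab n : SL_stabilizer phi (s n).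
  split=> [|x].
    by rewrite /s det_mulmx det_mulmx detc // mulr1 -det_mulmx hih det1.
  have phiE : phi x = hi *m psi 0%N x *m hi^T.
    rewrite hE !mulmxA hih mul1mx -!mulmxA -trmx_mul hih trmx1 mulmx1 //.
  rewrite [in RHS]phiE -(cfix n.+1%:R) // hE /s !trmx_mul !mulmxA //.
suff : finite_set [set: nat] by apply: infinite_nat.
suff <- : s @^-1` SL_stabilizer phi = [set: nat].
  apply: finite_preimage fin => m n _ _ eqs.
  have : D m.+1%:R = D n.+1%:R.
    have DE t : D t = g *m (h *m (hi *m c t *m h) *m hi) *m gi.
      have -> : h *m (hi *m c t *m h) *m hi = c t.
        by rewrite -!mulmxA hhi mulmx1 !mulmxA hhi mul1mx.
      by rewrite /c -!mulmxA ggi mulmx1 !mulmxA ggi mul1mx.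
    by rewrite !DE -!/(s _) eqs.
  move=> /(congr1 (fun M : 'M[F]_6 => M i0 i0)); rewrite !mxE eqxx !mulr1n w1 !expr1z.
  by move=> /eqP; rewrite eqr_nat => /eqP[].
by apply/seteqP; split=> n // _; apply: stab.
Qed.

End Stability.

(** * Pfaffians *)

Section SkewMatrices.
Variable F : numFieldType.

Definition pf4 (m : nat -> nat -> F) i j k l :=
  m i j * m k l - m i k * m j l + m i l * m j k.

Definition pf6 (m : nat -> nat -> F) :=
  m 0 1 * pf4 m 2 3 4 5 - m 0 2 * pf4 m 1 3 4 5 + m 0 3 * pf4 m 1 2 4 5
  - m 0 4 * pf4 m 1 2 3 5 + m 0 5 * pf4 m 1 2 3 4.

Definition skew_entries (m : nat -> nat -> F) :=
  (forall i j, m j i = - m i j) /\ (forall i, m i i = 0).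

Definition mk n (m : nat -> nat -> F) : 'M[F]_n := \matrix_(i, j) m i j.

(* The partial derivatives of the Pfaffian. *)
Definition adj4 (m : nat -> nat -> F) i j := nth 0 (nth [::]
  [:: [:: 0; m 2 3; - m 1 3; m 1 2];
      [:: - m 2 3; 0; m 0 3; - m 0 2];
      [:: m 1 3; - m 0 3; 0; m 0 1];
      [:: - m 1 2; m 0 2; - m 0 1; 0]] i) j.

Definition adj6 (m : nat -> nat -> F) i j := let p := pf4 m in nth 0 (nth [::]
  [:: [:: 0; p 2 3 4 5; - p 1 3 4 5; p 1 2 4 5; - p 1 2 3 5; p 1 2 3 4];
      [:: - p 2 3 4 5; 0; p 0 3 4 5; - p 0 2 4 5; p 0 2 3 5; - p 0 2 3 4];
      [:: p 1 3 4 5; - p 0 3 4 5; 0; p 0 1 4 5; - p 0 1 3 5; p 0 1 3 4];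
      [:: - p 1 2 4 5; p 0 2 4 5; - p 0 1 4 5; 0; p 0 1 2 5; - p 0 1 2 4];
      [:: p 1 2 3 5; - p 0 2 3 5; p 0 1 3 5; - p 0 1 2 5; 0; p 0 1 2 3];
      [:: - p 1 2 3 4; p 0 2 3 4; - p 0 1 3 4; p 0 1 2 4; - p 0 1 2 3; 0]] i) j.

(** The Pfaffian analogue of the adjugate identity: a nonzero Pfaffian gives an explicit inverse,
    with no determinant to expand. *)
Lemma mul_adj4 m : skew_entries m -> mk 4 m *m mk 4 (adj4 m) = (- pf4 m 0 1 2 3)%:M.
Proof.
move=> [sk dg]; apply/matrixP => i j; rewrite !mxE !big_ord_recl big_ord0 !mxE.
case: i => [[|[|[|[|//]]]] ?]; case: j => [[|[|[|[|//]]]] ?];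
  rewrite /adj4 /pf4 /bump /= ?dg ?(sk 0 1) ?(sk 0 2) ?(sk 0 3) ?(sk 1 2) ?(sk 1 3)
    ?(sk 2 3) ?mulr1n ?mulr0n; ring.
Qed.

Lemma mul_adj6 m : skew_entries m -> mk 6 m *m mk 6 (adj6 m) = (- pf6 m)%:M.
Proof.
move=> [sk dg]; apply/matrixP => i j; rewrite !mxE !big_ord_recl big_ord0 !mxE.
case: i => [[|[|[|[|[|[|//]]]]]] ?]; case: j => [[|[|[|[|[|[|//]]]]]] ?];
  rewrite /adj6 /pf6 /pf4 /bump /= ?dg ?(sk 0 1) ?(sk 0 2) ?(sk 0 3) ?(sk 0 4) ?(sk 0 5)
    ?(sk 1 2) ?(sk 1 3) ?(sk 1 4) ?(sk 1 5) ?(sk 2 3) ?(sk 2 4) ?(sk 2 5)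
    ?(sk 3 4) ?(sk 3 5) ?(sk 4 5) ?mulr1n ?mulr0n; ring.
Qed.

Lemma rank_scalar_factor n (M N : 'M[F]_n) a : a != 0 -> M *m N = a%:M -> \rank M = n.
Proof.
move=> a0 MN; apply: mxrank_unit.
have /mulmx1_unit[] // : M *m (a^-1 *: N) = 1%:M.
by rewrite -scalemxAr MN scale_scalar_mx mulVf.
Qed.

Lemma pf4_rank m : skew_entries m -> (\rank (mk 4 m) < 4)%N -> pf4 m 0 1 2 3 = 0.
Proof.
move=> sk; apply: contraTeq => pf0.
by rewrite (rank_scalar_factor _ (mul_adj4 sk)) ?oppr_eq0.
Qed.

Lemma pf6_rank m : skew_entries m -> (\rank (mk 6 m) < 6)%N -> pf6 m = 0.
Proof.
move=> sk; apply: contraTeq => pf0.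
by rewrite (rank_scalar_factor _ (mul_adj6 sk)) ?oppr_eq0.
Qed.

(** Natural indices let the Pfaffian formulas compute; an index out of range is read as index 0. *)
Definition entries n (M : 'M[F]_n.+1) i j := M (inord i) (inord j).

Lemma mk_entries n (M : 'M[F]_n.+1) : mk n.+1 (entries M) = M.
Proof. by apply/matrixP => i j; rewrite mxE /entries !inord_val. Qed.

Lemma skewE n (M : 'M[F]_n) i j : M^T = - M -> M j i = - M i j.
Proof. by move=> /matrixP/(_ i j); rewrite !mxE. Qed.

Lemma skew_diag n (M : 'M[F]_n) i : M^T = - M -> M i i = 0.
Proof.
move=> /(skewE i i)/eqP; rewrite -subr_eq0 opprK -mulr2n mulrn_eq0 /=.
by move/eqP.
Qed.

Lemma entries_skew n (M : 'M[F]_n.+1) : M^T = - M -> skew_entries (entries M).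
Proof. by move=> sk; split=> [i j|i]; [apply: skewE|apply: skew_diag]. Qed.

Lemma entries_mk n m i j : (i <= n)%N -> (j <= n)%N -> entries (mk n.+1 m) i j = m i j.
Proof. by move=> ip jp; rewrite /entries mxE !inordK. Qed.

Lemma congr_skew n p (g : 'M[F]_(n, p)) M : M^T = - M -> (g *m M *m g^T)^T = - (g *m M *m g^T).
Proof. by move=> sk; rewrite !trmx_mul trmxK sk mulNmx mulmxN mulmxA. Qed.

Lemma rank_congr n (g M : 'M[F]_n) : g \in unitmx -> \rank (g *m M *m g^T) = \rank M.
Proof.
move=> gu; rewrite mxrankMfree ?row_free_unit ?unitmx_tr // -[RHS]mxrank_tr.
by rewrite -mxrank_tr trmx_mul mxrankMfree // row_free_unit unitmx_tr.
Qed.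

(** The left side is the Pfaffian of [E *m M *m E^T], a 4 x 4 skew matrix of rank at most 2;
    repeated indices are allowed. *)
Lemma pluecker n (M : 'M[F]_n.+1) i j k l : M^T = - M -> (\rank M <= 2)%N ->
  M i j * M k l - M i k * M j l + M i l * M j k = 0.
Proof.
move=> sk rk.
pose E : 'M[F]_(4, n.+1) := \matrix_(r, s) (nth i [:: i; j; k; l] r == s)%:R.
pose m r s := M (nth i [:: i; j; k; l] r) (nth i [:: i; j; k; l] s).
have EM : E *m M *m E^T = mk 4 m.
  apply/matrixP => r s; rewrite !mxE (bigD1 (nth i [:: i; j; k; l] s)) //= big1 => [|t nt].
    rewrite addr0 !mxE eqxx mulr1 (bigD1 (nth i [:: i; j; k; l] r)) //= big1 => [|t nt].
      by rewrite addr0 !mxE eqxx mul1r.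
    by rewrite !mxE eq_sym (negPf nt) mul0r.
  by rewrite [E^T _ _]mxE [E _ _]mxE eq_sym (negPf nt) mulr0.
have := @pf4_rank m; apply.
  by split=> [r s|r]; [apply: skewE|apply: skew_diag].
rewrite -EM; apply: leq_ltn_trans (mxrankM_maxl _ _) _.
by apply: leq_ltn_trans (mxrankM_maxr _ _) _; apply: leq_ltn_trans rk _.
Qed.

Lemma rank_wedge n (u v : 'rV[F]_n) : (\rank (u^T *m v - v^T *m u)%R <= 2)%N.
Proof.
apply: leq_trans (mxrank_add _ _) _; rewrite mxrank_opp.
have r1 (a b : 'rV[F]_n) : (\rank (a^T *m b) <= 1)%N.
  by apply: leq_trans (mxrankM_maxr _ _) _; apply: rank_leq_row.
exact: (leq_add (r1 _ _) (r1 _ _)).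
Qed.

(** With a nonzero entry M i j as pivot, the relations say that M is the wedge of its rows i and j,
    divided by M i j. *)
Lemma rank_pluecker n (M : 'M[F]_n) : M^T = - M ->
  (forall i j k l, M i j * M k l - M i k * M j l + M i l * M j k = 0) ->
  (\rank M <= 2)%N.
Proof.
move=> sk pl; have [->|nz] := eqVneq M 0; first by rewrite mxrank0.
have [i [j nij]] : exists i j, M i j != 0.
  apply: contrapT => H; move/eqP: nz; apply; apply/matrixP => i j; rewrite mxE.
  by apply: contrapT => /eqP nij; apply: H; exists i, j.
suff -> : M = ((M i j)^-1 *: row i M)^T *m row j M - (row j M)^T *m ((M i j)^-1 *: row i M).
  exact: rank_wedge.
apply/matrixP => k l; rewrite !mxE !big_ord1 !mxE.
apply: (mulfI nij); move/eqP: (pl i j k l); rewrite -addrA addr_eq0 => /eqP ->.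
rewrite mulrBr; field => //.
Qed.

Lemma rank_skew3 (M : 'M[F]_3) : M^T = - M -> (\rank M <= 2)%N.
Proof.
move=> sk; rewrite -ltnS ltn_neqAle rank_leq_row andbT.
apply/negP => /eqP rk; have : row_free M by apply/eqP.
rewrite row_free_unit unitmxE unitfE => /eqP; apply; apply/eqP.
have := det_tr M; rewrite sk -scaleN1r detZ => /eqP.
rewrite -subr_eq0 -signr_odd expr1 mulN1r -opprD oppr_eq0 -mulr2n mulrn_eq0 //.
Qed.

End SkewMatrices.

(** * The cubic equation of the normal form *)

Section CrossProducts.
Variables (F : numFieldType) (V : vectType F).
Implicit Types (u v w : 'rV[F]_3) (x y z : V).

Definition dot u v : F := (u *m v^T) 0 0.

Lemma dotDl u v w : dot (u + v) w = dot u w + dot v w.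
Proof. by rewrite /dot mulmxDl mxE. Qed.
Lemma dotDr u v w : dot u (v + w) = dot u v + dot u w.
Proof. by rewrite /dot linearD mulmxDr mxE. Qed.
Lemma dotZl a u v : dot (a *: u) v = a * dot u v.
Proof. by rewrite /dot -scalemxAl mxE. Qed.
Lemma dotZr a u v : dot u (a *: v) = a * dot u v.
Proof. by rewrite /dot linearZ -scalemxAr mxE. Qed.
Lemma dotNl u v : dot (- u) v = - dot u v.
Proof. by rewrite -scaleN1r dotZl mulN1r. Qed.
Lemma dotNr u v : dot u (- v) = - dot u v.
Proof. by rewrite -scaleN1r dotZr mulN1r. Qed.
Lemma dot0r v : dot v 0 = 0. Proof. by rewrite /dot trmx0 mulmx0 mxE. Qed.
Lemma dot_delta u i : dot u (delta_mx 0 i) = u 0 i.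
Proof. by rewrite /dot trmx_delta -colE mxE. Qed.

Definition dotE := (dotDl, dotDr, dotZl, dotZr, dotNl, dotNr).

Definition parallelogram (Q : V -> F) :=
  forall x y, Q (x + y) + Q (x - y) = 2 * Q x + 2 * Q y.

(** Off the hyperplane al = 0 the factor can be cancelled. For y on it, y + x1, y - x1 and x1 are
    all off it, and the parallelogram law leaves 2 Q(y) = 0. *)
Lemma functional_quadric0 (al : V -> F) Q : additive al -> parallelogram Q ->
  (forall x, al x * Q x = 0) -> (exists x, al x != 0) -> forall x, Q x = 0.
Proof.
move=> alB par H [x1 x1nz] y.
have alN x : al (- x) = - al x by rewrite -sub0r alB -(subrr x) alB subrr sub0r.
have Qnz x : al x != 0 -> Q x = 0.
  by move=> nz; have /eqP := H x; rewrite mulf_eq0 (negPf nz) => /eqP.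
have [y0|/Qnz//] := eqVneq (al y) 0.
have := par y x1; rewrite (Qnz (y + x1)); last first.
  by rewrite -[x1]opprK alB y0 sub0r alN opprK.
rewrite (Qnz (y - x1)); last by rewrite alB y0 sub0r oppr_eq0.
rewrite (Qnz x1) // mulr0 !addr0 => /esym/eqP.
by rewrite mulf_eq0 pnatr_eq0 => /eqP.
Qed.

Variables (p : {linear V -> 'rV[F]_3}).
Hypothesis p_surj : forall v, exists x, p x = v.

Lemma section_exists : exists q : 'I_3 -> V, forall i, p (q i) = delta_mx 0 i.
Proof. by have /choice[q qE] := fun i => p_surj (delta_mx 0 i); exists q. Qed.

Lemma factor_through (W : vectType F) (f : {linear V -> W}) (q : 'I_3 -> V) :
  (forall i, p (q i) = delta_mx 0 i) -> (forall x, p x = 0 -> f x = 0) ->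
  forall x, f x = \sum_i p x 0 i *: f (q i).
Proof.
move=> qE f0 x; apply/eqP; rewrite -subr_eq0; apply/eqP.
under eq_bigr => i _ do rewrite -linearZ.
rewrite -linear_sum -linearB; apply: f0; rewrite linearB linear_sum /=.
under eq_bigr => i _ do rewrite linearZ qE.
by rewrite -row_sum_delta subrr.
Qed.

(** Polarization gives a(x).p(y) + a(y).p(x) = 0. As p is onto, a vanishes on its kernel, hence
    factors through p by a matrix which the same identity makes skew. *)
Lemma isotropic_skew (a : {linear V -> 'rV[F]_3}) : (forall x, dot (a x) (p x) = 0) ->
  exists2 S : 'M[F]_3, S^T = - S & forall x, a x = p x *m S.
Proof.
move=> ap0; have [q qE] := section_exists.
have pol x y : dot (a x) (p y) + dot (a y) (p x) = 0.
  have := ap0 (x + y); rewrite !linearD !dotE !ap0 add0r addr0 => <-; ring.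
have ker x : p x = 0 -> a x = 0.
  move=> px; apply/rowP => i; rewrite mxE -dot_delta -qE.
  by have := pol x (q i); rewrite px dot0r addr0.
exists (\matrix_i a (q i)).
  apply/matrixP => i j; rewrite !mxE; apply/eqP; rewrite -addr_eq0.
  by rewrite -!dot_delta -!qE pol.
move=> x; rewrite (factor_through qE ker) mulmx_sum_row.
by apply: eq_bigr => i _; rewrite rowK.
Qed.

Variables (al1 al2 : {scalar V}) (a b : {linear V -> 'rV[F]_3}).
Hypothesis al_indep : forall k1 k2,
  (forall x, k1 * al1 x + k2 * al2 x = 0) -> k1 = 0 /\ k2 = 0.
Hypothesis rel : forall x, al1 x * dot (b x) (p x) = al2 x * dot (a x) (p x).

Lemma dual_pair : exists x1 x2, [/\ al1 x1 = 1, al2 x1 = 0, al1 x2 = 0 & al2 x2 = 1].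
Proof.
have [x al1x] : exists x, al1 x != 0.
  apply: contrapT => H; have [] := al_indep (k1 := 1) (k2 := 0).
    move=> x; rewrite mul0r addr0 mul1r; apply: contrapT => /eqP nz.
    by apply: H; exists x.
  by move/eqP; rewrite oner_eq0.
have [y dnz] : exists y, al1 x * al2 y - al2 x * al1 y != 0.
  apply: contrapT => H; have [] := al_indep (k1 := - al2 x) (k2 := al1 x).
    move=> y; apply: contrapT => /eqP nz; apply: H; exists y.
    by apply: contraNneq nz => H; rewrite -H; apply/eqP; ring.
  by move=> _ /eqP; rewrite (negPf al1x).
exists ((al1 x * al2 y - al2 x * al1 y)^-1 *: (al2 y *: x - al2 x *: y)).
exists ((al1 x * al2 y - al2 x * al1 y)^-1 *: (al1 x *: y - al1 y *: x)).
by split; rewrite linearZ linearB !linearZ /=; field.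
Qed.

(** On the hyperplane al1 = 0 the relation reads al2 (a.p) = 0 with al2 not identically zero, so the
    quadratic form a.p vanishes there and is divisible by al1. Cancelling al1 in the relation then
    gives the formula for b. *)
Lemma common_factor : exists2 lam : {scalar V},
  forall x, dot (a x) (p x) = al1 x * lam x & forall x, dot (b x) (p x) = al2 x * lam x.
Proof.
have [x1 [x2 [a11 a21 a12 a22]]] := dual_pair.
pose pi x := x - al1 x *: x1.
have piB : {morph pi : x y / x - y}.
  by move=> x y; rewrite /pi linearB /= scalerBl !opprD !opprK addrACA.
have piD : {morph pi : x y / x + y}.
  by move=> x y; rewrite /pi linearD /= scalerDl opprD addrACA.
have Qa0 x : dot (a (pi x)) (p (pi x)) = 0.
  apply: (@functional_quadric0 (fun x => al2 (pi x)) (fun x => dot (a (pi x)) (p (pi x)))).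
  - by move=> y z; rewrite piB linearB.
  - by move=> y z; rewrite piB piD !(linearB, linearD) !dotE; ring.
  - by move=> y; rewrite -rel /pi linearB linearZ /= a11 mulr1 subrr mul0r.
  - by exists x2; rewrite /pi a12 scale0r subr0 a22 oner_eq0.
(* The quotient read off by expanding a.p at x - al1(x) x1, where it is zero. *)
pose lam x := dot (a x) (p x1) + dot (a x1) (p x) - al1 x * dot (a x1) (p x1).
have lamL : scalar lam.
  by move=> k x y; rewrite /lam !linearP /= !dotE; ring.
pose L : {scalar V} := HB.pack lam (GRing.isLinear.Build _ _ _ _ _ lamL).
have HQa x : dot (a x) (p x) = al1 x * lam x.
  have /eqP := Qa0 x; rewrite /pi !(linearB, linearZ) /= !dotE /lam => /eqP H.
  by apply/eqP; rewrite -subr_eq0 -H; apply/eqP; ring.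
exists L => // x; apply/eqP; rewrite -subr_eq0; apply/eqP.
apply: (@functional_quadric0 al1 (fun x => dot (b x) (p x) - al2 x * L x)).
- exact: linearB.
- move=> y z; rewrite (linearD L y z) (linearB L y z) (linearD al2 y z) (linearB al2 y z).
  by rewrite (linearD b y z) (linearB b y z) (linearD p y z) (linearB p y z) !dotE; ring.
- by move=> y; rewrite mulrBr rel HQa /=; ring.
- by exists x1; rewrite a11 oner_eq0.
Qed.

(* In the first case [lam] vanishes on the kernel of [p]; otherwise polarizing at a point
   of the kernel where it does not shows that [al1] and [al2] factor through [p]. *)
Lemma pfaffian_dichotomy :
  (exists u S T, [/\ S^T = - S, T^T = - T,
     forall x, a x = al1 x *: u + p x *m S & forall x, b x = al2 x *: u + p x *m T])
  \/
  (exists (lam : {scalar V}) u1 u2 S T,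
    [/\ exists2 z, p z = 0 & lam z != 0, S^T = - S /\ T^T = - T,
        (forall x, al1 x = dot u1 (p x)) /\ (forall x, al2 x = dot u2 (p x)),
        forall x, a x = lam x *: u1 + p x *m S & forall x, b x = lam x *: u2 + p x *m T]).
Proof.
have [q qE] := section_exists.
have [lam Ha Hb] := common_factor.
have fac (f : {scalar V}) : (forall x, p x = 0 -> f x = 0) ->
    exists u, forall x, f x = dot u (p x).
  move=> f0; exists (\row_i f (q i)) => x.
  rewrite (@factor_through F^o f q qE f0) /dot mxE.
  by apply: eq_bigr => i _; rewrite !mxE mulrC.
(* The difference c - f u pairs to zero with p, so [isotropic_skew] applies to it. *)
have sub (c : {linear V -> 'rV[F]_3}) (f : {scalar V}) (u : 'rV[F]_3) :
    (forall x, dot (c x) (p x) = f x * dot u (p x)) ->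
    exists2 S : 'M[F]_3, S^T = - S & forall x, c x = f x *: u + p x *m S.
  move=> H; pose d x := c x - f x *: u.
  have dL : linear d.
    move=> k x y; rewrite /d !linearP /= scalerDl scalerBr scalerA.
    by rewrite opprD addrACA.
  pose D : {linear V -> 'rV[F]_3} := HB.pack d (GRing.isLinear.Build _ _ _ _ _ dL).
  have [x|S skS DE] := @isotropic_skew D.
    by rewrite /= /d !dotE H subrr.
  by exists S => // x; rewrite -DE /= /d addrC subrK.
have [lam0|nlam] := pselect (forall x, p x = 0 -> lam x = 0); [left|right].
  have [u lamE] := fac lam lam0.
  have [S skS aE] := sub a al1 u (fun x => etrans (Ha x) (congr1 _ (lamE x))).
  have [T skT bE] := sub b al2 u (fun x => etrans (Hb x) (congr1 _ (lamE x))).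
  by exists u, S, T.
have /existsNP[z /not_implyP[pz /eqP lz]] := nlam.
have ker (c : {linear V -> 'rV[F]_3}) (f : {scalar V}) :
    (forall x, dot (c x) (p x) = f x * lam x) -> forall x, p x = 0 -> f x = 0.
  move=> H; have nz x : p x = 0 -> lam x != 0 -> f x = 0.
    move=> px lx; have := H x; rewrite px dot0r => /esym/eqP.
    by rewrite mulf_eq0 (negPf lx) orbF => /eqP.
  move=> x px; have [lx|/nz] := eqVneq (lam x) 0; last exact.
  have := nz (x + z); rewrite !linearD px pz lx !add0r /= => /(_ erefl lz).
  by rewrite (nz z pz lz) addr0.
have [u1 al1E] := fac al1 (ker _ _ Ha).
have [u2 al2E] := fac al2 (ker _ _ Hb).
have [S skS aE] := sub a lam u1
  (fun x => etrans (Ha x) (etrans (mulrC _ _) (congr1 _ (al1E x)))).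
have [T skT bE] := sub b lam u2
  (fun x => etrans (Hb x) (etrans (mulrC _ _) (congr1 _ (al2E x)))).
by exists lam, u1, u2, S, T; split=> //; exists z.
Qed.

End CrossProducts.

(** * Rank two loci of the normal forms *)

Section RankLoci.
Variables (F : numFieldType) (V : vectType F).
Implicit Types (phi : 'Hom(V, 'M[F]_6)) (x y z : V).

Definition entl phi i j x : F := entries (phi x) i j.

Lemma entl_linear phi i j : scalar (entl phi i j).
Proof. by move=> a x y; rewrite /entl /entries linearP !mxE. Qed.

HB.instance Definition _ phi i j :=
  GRing.isLinear.Build F V F *%R (entl phi i j) (entl_linear phi i j).

Definition triple (f g h : V -> F) x : 'rV[F]_3 := \row_k nth 0 [:: f x; g x; h x] k.

Lemma triple_linear (f g h : {scalar V}) : linear (triple f g h).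
Proof.
move=> a x y; apply/rowP => k; rewrite !mxE.
by case: k => [[|[|[|//]]] ?] /=; rewrite linearP.
Qed.

HB.instance Definition _ (f g h : {scalar V}) :=
  GRing.isLinear.Build F V 'rV[F]_3 *:%R (triple f g h) (triple_linear f g h).

Lemma dot_triple f g h f' g' h' x y :
  dot (triple f g h x) (triple f' g' h' y) = f x * f' y + g x * g' y + h x * h' y.
Proof. by rewrite /dot mxE !big_ord_recl big_ord0 !mxE /= addr0 addrA. Qed.

Lemma row3_ext (u v : 'rV[F]_3) :
  u 0 0 = v 0 0 -> u 0 1 = v 0 1 -> u 0 2%:R = v 0 2%:R -> u = v.
Proof.
move=> h0 h1 h2; apply/rowP => -[[|[|[|//]]] p].
- by rewrite (_ : Ordinal p = 0) //; apply/val_inj.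
- by rewrite (_ : Ordinal p = 1) //; apply/val_inj.
- by rewrite (_ : Ordinal p = 2%:R) //; apply/val_inj.
Qed.

Lemma ord3P (j : 'I_3) : [\/ j = 0, j = 1 | j = 2%:R].
Proof.
by case: j => [[|[|[|//]]] ?]; [constructor 1|constructor 2|constructor 3]; apply/val_inj.
Qed.

Lemma triple_eq0 f g h x : triple f g h x = 0 <-> [/\ f x = 0, g x = 0 & h x = 0].
Proof.
split=> [H|[h0 h1 h2]]; last by apply: row3_ext; rewrite !mxE.
by split; [have := congr1 (fun u : 'rV_3 => u 0 0) H |
  have := congr1 (fun u : 'rV_3 => u 0 1) H|
  have := congr1 (fun u : 'rV_3 => u 0 2%:R) H]; rewrite !mxE.
Qed.

Lemma surj_ker_dim n (f : {linear V -> 'rV[F]_n}) : (forall v, exists x, f x = v) ->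
  (\dim (lker (linfun f)) + n = \dim (fullv : {vspace V}))%N.
Proof.
move=> surj; rewrite -(limg_ker_dim (linfun f) fullv) capfv; congr (_ + _)%N.
suff -> : (linfun f @: fullv)%VS = fullv by rewrite dimvf /dim /= mul1n.
apply/eqP; rewrite eqEsubv subvf; apply/subvP => v _.
by have [x <-] := surj v; rewrite -[f x](lfunE f) memv_img ?memvf.
Qed.

Definition two_planes phi := exists V1 V2 : {vspace V},
  [/\ (\dim V1 + 3 <= \dim (fullv : {vspace V}))%N,
      (\dim V2 + 3 <= \dim (fullv : {vspace V}))%N
    & forall x, (\rank (phi x) <= 2)%N <-> x \in V1 \/ x \in V2].

Definition conic_case phi := \dim (fullv : {vspace V}) = 5%N /\
  exists2 Y : 3.-tuple V, free Y &
    forall x, (\rank (phi x) <= 2)%N <-> exists k s t, x = k *: veronese Y s t.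

Definition is_skew phi := forall x, (phi x)^T = - phi x.

(** Such a matrix comes from a 3 x 3 skew matrix, which is singular because 3 is odd and, by the
    present bound, has rank at most 2. *)
Lemma supported_rank (m : nat -> nat -> F) (r : seq nat) : skew_entries m ->
  size r = 3%N -> uniq r ->
  (forall i j, (i < 6)%N -> (j < 6)%N -> i \notin r -> m i j = 0) ->
  (\rank (mk 6 m) <= 2)%N.
Proof.
move=> [sk dg] szr ur H.
pose E : 'M[F]_(3, 6) := \matrix_(i, j) (nth 0%N r i == j)%:R.
pose N := mk 3 (fun i j => m (nth 0%N r i) (nth 0%N r j)).
have -> : mk 6 m = E^T *m N *m E.
  apply/matrixP => i j; rewrite !mxE.
  have sumE (f : 'I_3 -> F) (k : 'I_6) : \sum_(l < 3) f l * E l k =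
     if insub (index (k : nat) r) is Some l then f l else 0.
    case: insubP => [l _ lk|]; last first.
      move=> nk; have kr : (k : nat) \notin r by rewrite -index_mem szr.
      apply: big1 => l _; rewrite mxE; case: eqP => [lk|]; last by rewrite mulr0.
      by move: kr; rewrite -lk mem_nth // szr.
    have kr : (k : nat) \in r by rewrite -index_mem -lk szr ltn_ord.
    rewrite (bigD1 l) //= mxE lk nth_index // eqxx mulr1 big1 ?addr0 // => l' nl.
    rewrite mxE; case: eqP => [lk'|]; last by rewrite mulr0.
    by case/eqP: nl; apply/val_inj; rewrite /= lk -lk' index_uniq ?szr.
  rewrite sumE; case: insubP => [l _ lk|]; last first.
    move=> nj; have jr : (j : nat) \notin r by rewrite -index_mem szr.
    by rewrite sk H ?oppr0.
  rewrite mxE; under eq_bigr => k _ do rewrite mxE mulrC.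
  rewrite sumE; case: insubP => [l' _ lk'|]; last first.
    move=> ni; have ir : (i : nat) \notin r by rewrite -index_mem szr.
    by rewrite H.
  have ir : (i : nat) \in r by rewrite -index_mem -lk' szr ltn_ord.
  have jr : (j : nat) \in r by rewrite -index_mem -lk szr ltn_ord.
  by rewrite mxE lk lk' !nth_index.
apply: leq_trans (mxrankM_maxl _ _) _; apply: leq_trans (mxrankM_maxr _ _) _.
by apply: rank_skew3; apply/matrixP => i j; rewrite !mxE sk.
Qed.

(** The matrix is a direct sum of skew blocks on {0,1,5} and {2,3,4}. The Plücker relations make the
    product of any two entries from different blocks zero, so rank at most 2 means that one block
    vanishes. Each block takes all values, whence codimension 3. *)
Lemma two_planes_final phi : is_skew phi ->
  (forall x i j, (i < 2)%N -> (2 <= j < 5)%N -> entl phi i j x = 0) ->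
  (forall x j, (2 <= j < 5)%N -> entl phi 5 j x = 0) ->
  (forall v, exists x, triple (entl phi 3 4) (entl phi 4 2) (entl phi 2 3) x = v) ->
  (forall v, exists x, triple (entl phi 0 1) (entl phi 0 5) (entl phi 1 5) x = v) ->
  two_planes phi.
Proof.
move=> sk h01 h5 ps qs.
pose p : {linear V -> 'rV[F]_3} := triple (entl phi 3 4) (entl phi 4 2) (entl phi 2 3).
pose q : {linear V -> 'rV[F]_3} := triple (entl phi 0 1) (entl phi 0 5) (entl phi 1 5).
exists (lker (linfun p)), (lker (linfun q)); rewrite !surj_ker_dim //; split=> // x.
rewrite !memv_ker !lfunE.
have [skm dgm] := entries_skew (sk x).
rewrite -[phi x]mk_entries.
have z (i j : nat) : (i \in [:: 0; 1; 5])%N -> (2 <= j < 5)%N -> entries (phi x) i j = 0.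
  by rewrite !inE => /or3P[] /eqP -> ?; [apply: h01|apply: h01|apply: h5].
have zE := (z 0%N 2%N isT isT, z 0%N 3%N isT isT, z 0%N 4%N isT isT,
  z 1%N 2%N isT isT, z 1%N 3%N isT isT, z 1%N 4%N isT isT,
  z 5%N 2%N isT isT, z 5%N 3%N isT isT, z 5%N 4%N isT isT).
split=> [rk|[]/eqP/triple_eq0[]]; rewrite /entl; first last.
- rewrite /= /entl => h1 h2 h3; apply: (@supported_rank _ [:: 2; 3; 4]%N) => // i j i6 j6.
  case: i i6 => [|[|[|[|[|[|//]]]]]] // _ _; case: j j6 => [|[|[|[|[|[|//]]]]]] // _;
  by rewrite ?(dgm, zE, h1, h2, h3) // skm ?(zE, h1, h2, h3) oppr0.
- rewrite /= /entl => h1 h2 h3; apply: (@supported_rank _ [:: 0; 1; 5]%N) => // i j i6 j6.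
  case: i i6 => [|[|[|[|[|[|//]]]]]] // _ _; case: j j6 => [|[|[|[|[|[|//]]]]]] // _;
  by rewrite ?(dgm, zE, h1, h2, h3) // skm ?(zE, h1, h2, h3) oppr0.
have [|nz] := eqVneq (p x) 0; first by left; apply/eqP.
right; apply/eqP/triple_eq0.
have rk' : (\rank (phi x) <= 2)%N by rewrite -[phi x]mk_entries.
have pl i j k l : i \in [:: 0; 1; 5]%N -> j \in [:: 0; 1; 5]%N -> (2 <= k < 5)%N ->
    (2 <= l < 5)%N -> entries (phi x) i j * entries (phi x) k l = 0.
  move=> i1 j1 k2 l2.
  have := pluecker (inord i) (inord j) (inord k) (inord l) (sk x) rk'.
  rewrite -!/(entries _ _ _) (z i k) // (z i l) // !mul0r subr0 addr0 //.
have all0 i j : i \in [:: 0; 1; 5]%N -> j \in [:: 0; 1; 5]%N -> entl phi i j x = 0.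
  move=> i1 j1; apply/eqP; apply: contraNT nz => nz; apply/eqP/triple_eq0.
  by split; apply: (mulfI nz); rewrite mulr0; apply: pl.
by split; apply: all0.
Qed.


Lemma triple3 f g h x : (triple f g h x 0 0 = f x) * (triple f g h x 0 1 = g x) *
  (triple f g h x 0 2%:R = h x).
Proof. by rewrite !mxE. Qed.

Lemma dot3 (u v : 'rV[F]_3) : dot u v = u 0 0 * v 0 0 + u 0 1 * v 0 1 + u 0 2%:R * v 0 2%:R.
Proof.
rewrite /dot mxE !big_ord_recl big_ord0 !mxE addr0 addrA.
by congr (_ * _ + _ * _ + _ * _); congr (_ 0 _); apply/val_inj.
Qed.

Definition cross (u v : 'rV[F]_3) : 'rV[F]_3 := \row_k nth 0
  [:: u 0 1 * v 0 2%:R - u 0 2%:R * v 0 1; u 0 2%:R * v 0 0 - u 0 0 * v 0 2%:R;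
      u 0 0 * v 0 1 - u 0 1 * v 0 0] k.

Lemma cross3 u v :
  (cross u v 0 0 = u 0 1 * v 0 2%:R - u 0 2%:R * v 0 1) *
  (cross u v 0 1 = u 0 2%:R * v 0 0 - u 0 0 * v 0 2%:R) *
  (cross u v 0 2%:R = u 0 0 * v 0 1 - u 0 1 * v 0 0).
Proof. by rewrite !mxE. Qed.

Lemma orthogonal_cross (u v w : 'rV[F]_3) : dot u w = 0 -> dot v w = 0 -> cross u v != 0 ->
  exists k, w = k *: cross u v.
Proof.
rewrite !dot3 => uw vw nz.
move: (cross3 u v); move: (cross u v) nz => X nz XE.
have X01 : X 0 0 * w 0 1 = X 0 1 * w 0 0.
  rewrite !XE; apply/eqP; rewrite -subr_eq0; apply/eqP.
  have -> : 0 = v 0 2%:R * (u 0 0 * w 0 0 + u 0 1 * w 0 1 + u 0 2%:R * w 0 2%:R) -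
    u 0 2%:R * (v 0 0 * w 0 0 + v 0 1 * w 0 1 + v 0 2%:R * w 0 2%:R) :> F.
    by rewrite uw vw !mulr0 subrr.
  ring.
have X02 : X 0 0 * w 0 2%:R = X 0 2%:R * w 0 0.
  rewrite !XE; apply/eqP; rewrite -subr_eq0; apply/eqP.
  have -> : 0 = u 0 1 * (v 0 0 * w 0 0 + v 0 1 * w 0 1 + v 0 2%:R * w 0 2%:R) -
    v 0 1 * (u 0 0 * w 0 0 + u 0 1 * w 0 1 + u 0 2%:R * w 0 2%:R) :> F.
    by rewrite uw vw !mulr0 subrr.
  ring.
have X12 : X 0 1 * w 0 2%:R = X 0 2%:R * w 0 1.
  rewrite !XE; apply/eqP; rewrite -subr_eq0; apply/eqP.
  have -> : 0 = v 0 0 * (u 0 0 * w 0 0 + u 0 1 * w 0 1 + u 0 2%:R * w 0 2%:R) -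
    u 0 0 * (v 0 0 * w 0 0 + v 0 1 * w 0 1 + v 0 2%:R * w 0 2%:R) :> F.
    by rewrite uw vw !mulr0 subrr.
  ring.
have [n0|n0] := eqVneq (X 0 0) 0; last first.
  exists (w 0 0 / X 0 0); apply: row3_ext; rewrite !mxE; first by field.
    by apply: (mulfI n0); rewrite X01; field.
  by apply: (mulfI n0); rewrite X02; field.
have [n1|n1] := eqVneq (X 0 1) 0; last first.
  exists (w 0 1 / X 0 1); apply: row3_ext; rewrite !mxE; last 2 first.
  - by field.
  - by apply: (mulfI n1); rewrite X12; field.
  by apply: (mulfI n1); rewrite -X01; field.
have n2 : X 0 2%:R != 0.
  by apply: contraNneq nz => n2; apply/eqP/row3_ext; rewrite ?mxE.
exists (w 0 2%:R / X 0 2%:R); apply: row3_ext; rewrite !mxE; last by field.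
  by apply: (mulfI n2); rewrite -X02; field.
by apply: (mulfI n2); rewrite -X12; field.
Qed.

(** For skew [phi] this says that [phi z] is a nonzero multiple of e0^e1. *)
Definition base_form phi z := entl phi 0 1 z != 0 /\
  forall i j, (i < 6)%N -> (1 < j < 6)%N -> entl phi i j z = 0.

Lemma conic_final phi (lam : {scalar V}) (u1 u2 : 'rV[F]_3) z z2 :
  let p := triple (entl phi 3 4) (entl phi 4 2) (entl phi 2 3) in
  is_skew phi -> lker phi = 0%VS ->
  (forall x j, (2 <= j < 5)%N -> entl phi 5 j x = 0) ->
  (forall v, exists x, p x = v) ->
  (forall k1 k2, (forall x, k1 * entl phi 0 5 x + k2 * entl phi 1 5 x = 0) ->
     k1 = 0 /\ k2 = 0) ->
  base_form phi z -> p z2 = 0 -> lam z2 != 0 ->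
  (forall x, entl phi 0 5 x = dot u1 (p x)) ->
  (forall x, entl phi 1 5 x = dot u2 (p x)) ->
  (forall x, triple (entl phi 0 2) (entl phi 0 3) (entl phi 0 4) x = lam x *: u1) ->
  (forall x, triple (entl phi 1 2) (entl phi 1 3) (entl phi 1 4) x = lam x *: u2) ->
  conic_case phi.
Proof.
move=> p sk ker0 h5 ps ind [zc z0] pz2 lz2 al1E al2E aE bE.
pose pL : {linear V -> 'rV[F]_3} := triple (entl phi 3 4) (entl phi 4 2) (entl phi 2 3).
have pLE x : p x = pL x by [].
pose c : {scalar V} := entl phi 0 1.
have fN (f : {scalar V}) x : f (- x) = - f x by rewrite linearN.
have fD (f : {scalar V}) x y : f (x + y) = f x + f y by rewrite linearD.
have fZ (f : {scalar V}) k x : f (k *: x) = k * f x by rewrite linearZ.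
have f0 (f : {scalar V}) : f 0 = 0 by rewrite linear0.
have pN x : p (- x) = - p x by apply: (linearN pL).
have pD x y : p (x + y) = p x + p y by apply: (linearD pL).
have pZ k x : p (k *: x) = k *: p x by rewrite !pLE linearZ.
have p0 : p 0 = 0 by apply: (linear0 pL).
have linE := (pN, pD, pZ, p0, fN lam, fD lam, fZ lam, f0 lam, fN c, fD c, fZ c, f0 c).
(* The direction orthogonal to u1 and u2; it is nonzero because al1 = u1.p and al2 = u2.p are
   independent. *)
pose X := cross u1 u2.
have Xnz : X != 0.
  apply/eqP => X0.
  have Xe := cross3 u1 u2; rewrite -/X X0 !mxE in Xe.
  have e0 : u1 0 1 * u2 0 2%:R = u1 0 2%:R * u2 0 1 by apply/eqP; rewrite -subr_eq0 -Xe.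
  have e1 : u1 0 2%:R * u2 0 0 = u1 0 0 * u2 0 2%:R by apply/eqP; rewrite -subr_eq0 -Xe.
  have e2 : u1 0 0 * u2 0 1 = u1 0 1 * u2 0 0 by apply/eqP; rewrite -subr_eq0 -Xe.
  have u2j j : u2 0 j = 0.
    have [|//] := ind (u2 0 j) (- u1 0 j).
      move=> x; rewrite al1E al2E !dot3.
      case: (ord3P j) => [->|->|->].
      - have -> : 0 = - (u1 0 0 * u2 0 1 - u1 0 1 * u2 0 0) * p x 0 1
          + (u1 0 2%:R * u2 0 0 - u1 0 0 * u2 0 2%:R) * p x 0 2%:R :> F.
          by rewrite e1 e2 !subrr oppr0 !mul0r addr0.
        ring.
      - have -> : 0 = (u1 0 0 * u2 0 1 - u1 0 1 * u2 0 0) * p x 0 0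
          - (u1 0 1 * u2 0 2%:R - u1 0 2%:R * u2 0 1) * p x 0 2%:R :> F.
          by rewrite e0 e2 !subrr !mul0r subr0.
        ring.
      - have -> : 0 = (u1 0 1 * u2 0 2%:R - u1 0 2%:R * u2 0 1) * p x 0 1
          - (u1 0 2%:R * u2 0 0 - u1 0 0 * u2 0 2%:R) * p x 0 0 :> F.
          by rewrite e0 e1 !subrr !mul0r subr0.
        ring.
  have [|_ /eqP] := ind 0 1; last by rewrite oner_eq0.
  by move=> x; rewrite mul0r add0r mul1r al2E dot3 !u2j !mul0r !addr0.
have m0 x : (entl phi 0 2 x = lam x * u1 0 0) * (entl phi 0 3 x = lam x * u1 0 1) *
    (entl phi 0 4 x = lam x * u1 0 2%:R).
  have := triple3 (entl phi 0 2) (entl phi 0 3) (entl phi 0 4) x.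
  by rewrite aE !mxE => -[[-> ->] ->].
have m1 x : (entl phi 1 2 x = lam x * u2 0 0) * (entl phi 1 3 x = lam x * u2 0 1) *
    (entl phi 1 4 x = lam x * u2 0 2%:R).
  have := triple3 (entl phi 1 2) (entl phi 1 3) (entl phi 1 4) x.
  by rewrite bE !mxE => -[[-> ->] ->].
have mp x : (entl phi 3 4 x = p x 0 0) * (entl phi 4 2 x = p x 0 1) *
    (entl phi 2 3 x = p x 0 2%:R).
  by rewrite /p !triple3.
pose tab x i j := nth 0 (nth [::]
  [:: [:: 0; c x; lam x * u1 0 0; lam x * u1 0 1; lam x * u1 0 2%:R; dot u1 (p x)];
      [:: - c x; 0; lam x * u2 0 0; lam x * u2 0 1; lam x * u2 0 2%:R; dot u2 (p x)];
      [:: - (lam x * u1 0 0); - (lam x * u2 0 0); 0; p x 0 2%:R; - p x 0 1; 0];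
      [:: - (lam x * u1 0 1); - (lam x * u2 0 1); - p x 0 2%:R; 0; p x 0 0; 0];
      [:: - (lam x * u1 0 2%:R); - (lam x * u2 0 2%:R); p x 0 1; - p x 0 0; 0; 0];
      [:: - dot u1 (p x); - dot u2 (p x); 0; 0; 0; 0]] i) j.
have phiE x : phi x = mk 6 (tab x).
  have [skm dgm] := entries_skew (sk x).
  rewrite -[LHS]mk_entries; apply/matrixP => i j; rewrite !mxE.
  have skl k l : entl phi l k x = - entl phi k l x by apply: skm.
  have h5x k := h5 x k.
  rewrite -/(entl _ _ _ _) /tab /c.
  case: i => [[|[|[|[|[|[|//]]]]]] ?]; case: j => [[|[|[|[|[|[|//]]]]]] ?] //=;
  rewrite ?[entl _ 0 0 x]dgm ?[entl _ 1 1 x]dgm ?[entl _ 2 2 x]dgm ?[entl _ 3 3 x]dgm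
    ?[entl _ 4 4 x]dgm ?[entl _ 5 5 x]dgm
    ?(h5x 2%N isT) ?(h5x 3%N isT) ?(h5x 4%N isT) ?m0 ?m1 ?mp ?al1E ?al2E //;
  by rewrite skl ?h5x ?m0 ?m1 ?mp ?al1E ?al2E ?oppr0.
(* The table depends only on p, lam and c, and [phi] is injective; this is what bounds the dimension
   by 5. *)
have inj x : p x = 0 -> lam x = 0 -> c x = 0 -> x = 0.
  move=> px lx cx; apply/eqP; rewrite -memv0 -ker0 memv_ker phiE; apply/eqP/matrixP => i j.
  rewrite !mxE /tab px lx cx !dot0r !mxE !mul0r !oppr0.
  by case: i => [[|[|[|[|[|[|//]]]]]] ?]; case: j => [[|[|[|[|[|[|//]]]]]] ?].
have pz : p z = 0 by apply/triple_eq0; split; apply: z0.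
(* The entries lam(z) u1 of [phi z] vanish, and u1 is nonzero since X is. *)
have lz : lam z = 0.
  apply/eqP; apply: contraNT Xnz => lnz; apply/eqP.
  have u10 j : u1 0 j = 0.
    by case: (ord3P j) => [->|->|->]; apply: (@mulfI F _ lnz); rewrite mulr0 -m0 z0.
  by apply: row3_ext; rewrite cross3 !u10 !mul0r subrr mxE.
(* The vectors y1, y2, y3 are built to have (c, lam, p) equal to (1, 0, 0), (0, 1, 0), (0, 0, X), so
   that c, lam and the factor k of p = k X become coordinates on their span. *)
pose y1 := (c z)^-1 *: z.
have cz : c z != 0 by [].
have y1E : [/\ p y1 = 0, lam y1 = 0 & c y1 = 1].
  by rewrite /y1 !linE pz lz mulVf // scaler0 mulr0.
have [py1 ly1 cy1] := y1E; clearbody y1.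
pose y2 := (lam z2)^-1 *: (z2 - c z2 *: y1).
have [py2 ly2 cy2] : [/\ p y2 = 0, lam y2 = 1 & c y2 = 0].
  rewrite /y2 !linE pz2 py1 ly1 cy1.
  by rewrite scaler0 subr0 scaler0 mulr0 subr0 mulVf // mulr1 subrr mulr0.
clearbody y2; have [w pw] := ps X.
pose y3 := w - lam w *: y2 - c w *: y1.
have [py3 ly3 cy3] : [/\ p y3 = X, lam y3 = 0 & c y3 = 0].
  rewrite /y3 !linE pw py1 py2 ly1 ly2 cy1 cy2.
  by rewrite !scaler0 !mulr0 !mulr1 !subr0 !subrr.
clearbody y3; have decomp x k : p x = k *: X -> x = c x *: y1 + lam x *: y2 + k *: y3.
  move=> px; apply/eqP; rewrite -subr_eq0; apply/eqP; apply: inj.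
  - rewrite !linE py1 py2 py3 px.
    by rewrite !scaler0 !add0r subrr.
  - rewrite !linE ly1 ly2 ly3; ring.
  - rewrite !linE cy1 cy2 cy3; ring.
pose Y := [tuple y1; y2; y3].
have lin3Y k1 k2 k3 : lin3 Y k1 k2 k3 = k1 *: y1 + k2 *: y2 + k3 *: y3 by [].
have eval k1 k2 k3 : [/\ p (lin3 Y k1 k2 k3) = k3 *: X, lam (lin3 Y k1 k2 k3) = k2
    & c (lin3 Y k1 k2 k3) = k1].
  rewrite lin3Y !linE py1 py2 py3 ly1 ly2 ly3 cy1 cy2 cy3.
  by rewrite !scaler0 !add0r !mulr0 !mulr1 !addr0 add0r.
have k0 k1 k2 k3 : lin3 Y k1 k2 k3 = 0 -> [/\ k1 = 0, k2 = 0 & k3 = 0].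
  move=> H; have [] := eval k1 k2 k3; rewrite H !linE.
  move=> /esym/eqP; rewrite scaler_eq0 (negPf Xnz) orbF => /eqP -> <- <-.
  by [].
split.
  have := surj_ker_dim (f := pL) ps; rewrite -[RHS]/(\dim _) => <-.
  suff -> : lker (linfun pL) = <<[:: y1; y2]>>%VS.
    suff /eqnP -> : free [:: y1; y2] by [].
    rewrite free_cons seq1_free span_seq1; apply/andP; split; last first.
      by apply/eqP => y20; move: ly2; rewrite y20 !linE => /eqP; rewrite eq_sym oner_eq0.
    apply/negP => /vlineP[k kE]; move: cy1; rewrite kE !linE cy2 mulr0 => /eqP.
    by rewrite eq_sym oner_eq0.
  apply/eqP; rewrite eqEsubv; apply/andP; split; apply/subvP => x.
    rewrite memv_ker lfunE => /eqP px.
    have := decomp x 0; rewrite scale0r => /(_ px) ->.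
    rewrite scale0r addr0 span_cons span_seq1.
    by rewrite memv_add ?memvZ ?memv_line.
  rewrite span_cons span_seq1 => /memv_addP[_ /vlineP[k ->] [_ /vlineP[l ->] ->]].
  by rewrite memv_ker lfunE -pLE !linE py1 py2 !scaler0 addr0.
exists Y.
  apply/freeP => k; rewrite !big_ord_recl big_ord0 /= addr0 addrA => /k0[h0 h1 h2] i.
  case: i => [[|[|[|//]]] q]; [rewrite -h0|rewrite -h1|rewrite -h2];
  by congr (k _); apply/val_inj.
move=> x; split=> [rk|[k [s [t ->]]]]; last first.
  have [pv lv cv] := eval (s ^+ 2) (s * t) (t ^+ 2).
  have -> : phi (k *: veronese Y s t) = k *: phi (veronese Y s t) by rewrite linearZ.
  apply: leq_trans (mxrankS (scalemx_sub k (submx_refl (phi (veronese Y s t))))) _.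
  rewrite phiE /veronese.
  (* The decomposition (s e0 - t u2) ^ (s e1 + t u1) = s^2 e0^e1 + s t (e0^u1 + e1^u2) + t^2
     u1^u2. *)
  pose v1 : 'rV[F]_6 := \row_j nth 0
    [:: s; 0; - (t * u2 0 0); - (t * u2 0 1); - (t * u2 0 2%:R); 0] j.
  pose v2 : 'rV[F]_6 := \row_j nth 0
    [:: 0; s; t * u1 0 0; t * u1 0 1; t * u1 0 2%:R; 0] j.
  suff -> : mk 6 (tab (lin3 Y (s ^+ 2) (s * t) (t ^+ 2))) = v1^T *m v2 - v2^T *m v1.
    exact: rank_wedge.
  apply/matrixP => i j; rewrite !mxE !big_ord1 !mxE /tab pv lv cv !dotZr !dot3 !mxE.
  by case: i => [[|[|[|[|[|[|//]]]]]] ?]; case: j => [[|[|[|[|[|[|//]]]]]] ?] /=; ring.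
have pl i j k l := pluecker (inord i) (inord j) (inord k) (inord l) (sk x) rk.
have plE i j k l : entl phi i j x * entl phi k l x - entl phi i k x * entl phi j l x
  + entl phi i l x * entl phi j k x = 0 by apply: pl.
(* The Plücker relations on i, 5 and two of 2, 3, 4. Either factor being zero gives u_i.p = 0, so p
   is a multiple of X. *)
have alp i : (i < 2)%N -> entl phi i 5 x *: p x = 0.
  move=> i2; apply/row3_ext; rewrite !mxE.
  - by have := plE i 5%N 3%N 4%N; rewrite !h5 // !mulr0 subr0 addr0.
  - by have := plE i 5%N 4%N 2%N; rewrite !h5 // !mulr0 subr0 addr0.
  - by have := plE i 5%N 2%N 3%N; rewrite !h5 // !mulr0 subr0 addr0.
have alp0 u i : (i < 2)%N -> entl phi i 5 x = dot u (p x) -> dot u (p x) = 0.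
  move=> i2 E; have /eqP := alp i i2; rewrite scaler_eq0 => /orP[/eqP <- //|/eqP ->].
  by rewrite dot0r.
have [k pk] := orthogonal_cross (alp0 u1 0%N isT (al1E x)) (alp0 u2 1%N isT (al2E x)) Xnz.
(* The relations on 0, 1 and two of 2, 3, 4 are the coordinates of c p = lam^2 X. *)
have ck : c x * k = lam x ^+ 2.
  have : (c x * k - lam x ^+ 2) *: X = 0.
    rewrite scalerBl -scalerA -pk; apply: row3_ext; rewrite !mxE.
    - rewrite -[RHS](plE 0%N 1%N 3%N 4%N) !m0 !m1 /c /=; ring.
    - rewrite -[RHS](plE 0%N 1%N 4%N 2%N) !m0 !m1 /c /=; ring.
    - rewrite -[RHS](plE 0%N 1%N 2%N 3%N) !m0 !m1 /c /=; ring.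
  by move=> /eqP; rewrite scaler_eq0 (negPf Xnz) orbF subr_eq0 => /eqP.
have xE := decomp x k pk.
have [c0|c0] := eqVneq (c x) 0.
  have l0 : lam x = 0 by apply/eqP; rewrite -sqrf_eq0 -ck c0 mul0r.
  exists k, 0, 1; rewrite {1}xE c0 l0 -lin3Y /veronese lin3Z; congr lin3; ring.
exists (c x)^-1, (c x), (lam x); rewrite {1}xE -lin3Y /veronese lin3Z; congr lin3.
- by field.
- by field.
by rewrite -ck; field.
Qed.

End RankLoci.

(** * Spaces of singular forms in four variables *)

Section NormalForms.
Variables (F : numFieldType).

Lemma mk_congr n T m : mk n T *m mk n m *m (mk n T)^T =
  mk n (fun i j => \sum_(k < n) (\sum_(l < n) T i l * m l k) * T j k) :> 'M[F]_n.
Proof.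
apply/matrixP => i j; rewrite !mxE; apply: eq_bigr => k _; rewrite !mxE; congr (_ * _).
by apply: eq_bigr => l _; rewrite !mxE.
Qed.

Lemma sum4 (f : nat -> F) : \sum_(i < 4) f i = f 0%N + f 1%N + f 2%N + f 3%N.
Proof. by rewrite !big_ord_recl big_ord0 addr0 !addrA. Qed.

Lemma sum6 (f : nat -> F) :
  \sum_(i < 6) f i = f 0%N + f 1%N + f 2%N + f 3%N + f 4%N + f 5%N.
Proof. by rewrite !big_ord_recl big_ord0 addr0 !addrA. Qed.

Lemma unit_table n T N (a : F) : mk n T *m mk n N = a%:M -> a != 0 -> mk n T \in unitmx.
Proof.
move=> TN a0; have /mulmx1_unit[] // : mk n T *m (a^-1 *: mk n N) = 1%:M.
by rewrite -scalemxAr TN scale_scalar_mx mulVf.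
Qed.

(** Undoing the row basis of the rank factorization on the right kills all columns from the rank on;
    acting by congruence keeps the matrix skew, so the same rows vanish. *)
Lemma rank2_normal_form n (M : 'M[F]_n) : M^T = - M -> (\rank M <= 2)%N ->
  exists2 g, g \in unitmx &
    forall i j : 'I_n, (1 < i)%N || (1 < j)%N -> (g *m M *m g^T) i j = 0.
Proof.
move=> sk rk; exists (invmx (row_ebase M))^T.
  by rewrite unitmx_tr unitmx_inv row_ebase_unit.
set g := (_)^T.
have col0 (i j : 'I_n) : (1 < j)%N -> (g *m M *m g^T) i j = 0.
  move=> j1; rewrite -[X in g *m X](mulmx_ebase M) /g trmxK !mulmxA mulmxK ?row_ebase_unit //.
  rewrite mxE big1 // => k _; rewrite [pid_mx _ _ _]mxE.
  case: eqP => //= [kj|]; rewrite ?mulr0 //.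
  by rewrite kj ltnNge (leq_trans rk j1) mulr0.
move=> i j /orP[i1|]; last exact: col0.
by rewrite (skewE j i (congr_skew g sk)) col0 ?oppr0.
Qed.

Lemma normal_form_neq0 (M : 'M[F]_4) : M^T = - M ->
  (forall i j : 'I_4, (1 < i)%N || (1 < j)%N -> M i j = 0) -> M != 0 -> entries M 0 1 != 0.
Proof.
move=> sk H; apply: contra_neq => m01; have [skm dgm] := entries_skew sk.
rewrite -[M]mk_entries; apply/matrixP => i j; rewrite !mxE.
have H' k l : (k < 4)%N -> (l < 4)%N -> (1 < k)%N || (1 < l)%N -> entries M k l = 0.
  by move=> k4 l4 kl; apply: H; rewrite !inordK.
have [ij|] := boolP ((1 < i)%N || (1 < j)%N); first exact: H'.
case: i => [[|[|//]] ?]; case: j => [[|[|//]] ?] //= _; rewrite ?dgm ?m01 //.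
by rewrite skm m01 oppr0.
Qed.

Lemma rank_pf4 (m : nat -> nat -> F) : skew_entries m -> pf4 m 0 1 2 3 = 0 ->
  (\rank (mk 4 m) <= 2)%N.
Proof.
move=> [sk dg] pf0; apply: rank_pluecker; first by apply/matrixP => i j; rewrite !mxE.
have e : m 0%N 1%N * m 2%N 3%N = m 0%N 2%N * m 1%N 3%N - m 0%N 3%N * m 1%N 2%N.
  by apply/eqP; rewrite -subr_eq0 -pf0 /pf4; apply/eqP; ring.
move=> i j k l; rewrite !mxE.
by case: i => [[|[|[|[|//]]]] ?]; case: j => [[|[|[|[|//]]]] ?];
   case: k => [[|[|[|[|//]]]] ?]; case: l => [[|[|[|[|//]]]] ?] /=;
   rewrite ?dg ?(sk 0 1) ?(sk 0 2) ?(sk 0 3) ?(sk 1 2) ?(sk 1 3) ?(sk 2 3);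
   first [ring | rewrite -pf0 /pf4; ring | rewrite -[RHS]oppr0 -pf0 /pf4; ring].
Qed.


(** A group is not the union of two proper subgroups. *)
Lemma add_prod0 (V : zmodType) (f g : V -> F) :
  {morph f : x y / x + y} -> {morph g : x y / x + y} -> (forall x, f x * g x = 0) ->
  (forall x, f x = 0) \/ (forall x, g x = 0).
Proof.
move=> fD gD fg0; apply: contrapT => /not_orP[/existsNP[x /eqP fx] /existsNP[y /eqP gy]].
have gx : g x = 0 by have /eqP := fg0 x; rewrite mulf_eq0 (negPf fx) => /eqP.
have fy : f y = 0 by have /eqP := fg0 y; rewrite mulf_eq0 (negPf gy) orbF => /eqP.
have /eqP := fg0 (x + y); rewrite fD gD fy gx addr0 add0r mulf_eq0.
by rewrite (negPf fx) (negPf gy).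
Qed.

Lemma det2 (M : 'M[F]_2) : \det M = M 0 0 * M 1 1 - M 0 1 * M 1 0.
Proof.
rewrite (expand_det_row _ 0) !big_ord_recl big_ord0 addr0 /cofactor !det_mx11 !mxE /=.
rewrite !expr0 !expr1 mul1r mulN1r mulrN.
by congr (_ * M _ _ - _ * M _ _); try congr (M _ _); apply/val_inj.
Qed.

Lemma ord2P (j : 'I_2) : j = 0 \/ j = 1.
Proof. by case: j => [[|[|//]] ?]; [left|right]; apply/val_inj. Qed.

(** Normalize a nonzero value to the matrix unit at (0,0). Adding it to a singular T changes the
    determinant by T11, so T11 = 0; then T01 T10 = 0 for all values, and one of the two entries
    vanishes identically. *)
Lemma singular_space2 (V : zmodType) (S : V -> 'M[F]_2) : {morph S : x y / x + y} ->
  (forall x, \det (S x) = 0) ->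
  (exists2 u : 'rV_2, u != 0 & forall x, u *m S x = 0) \/
  (exists2 v : 'cV_2, v != 0 & forall x, S x *m v = 0).
Proof.
move=> SD det0.
have [S0|/existsNP[x0 /eqP nz]] := pselect (forall x, S x = 0).
  left; exists (delta_mx 0 0) => [|x]; last by rewrite S0 mulmx0.
  by apply/eqP => /matrixP/(_ 0 0)/eqP; rewrite !mxE !eqxx oner_eq0.
have rk1 : \rank (S x0) = 1%N.
  apply/eqP; rewrite eqn_leq lt0n mxrank_eq0 nz andbT -ltnS ltn_neqAle rank_leq_row andbT.
  by apply: contra_eqN (det0 x0); rewrite -[_ == _]/(row_free _) row_free_unit unitmxE unitfE.
pose P := invmx (col_ebase (S x0)); pose Q := invmx (row_ebase (S x0)).
have Pu : P \in unitmx by rewrite unitmx_inv col_ebase_unit.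
have Qu : Q \in unitmx by rewrite unitmx_inv row_ebase_unit.
pose T x := P *m S x *m Q.
have TD i j : {morph (fun x => T x i j) : x y / x + y}.
  by move=> x y; rewrite /T SD mulmxDr mulmxDl mxE.
have detT x : \det (T x) = 0 by rewrite /T !det_mulmx det0 mulr0 mul0r.
have T0 : T x0 = pid_mx 1.
  rewrite /T -[X in P *m X *m _](mulmx_ebase (S x0)) rk1 !mulmxA.
  by rewrite mulVmx ?col_ebase_unit // mul1mx mulmxK ?row_ebase_unit.
have T11 x : T x 1 1 = 0.
  have := detT (x0 + x); have := detT x; rewrite !det2 !TD T0 !mxE /= => d1.
  rewrite !add0r mulrDl mul1r -addrA d1 addr0 => //.
have [|T01|T10] := @add_prod0 V (fun x => T x 0 1) (fun x => T x 1 0) (TD 0 1) (TD 1 0).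
- by move=> x; have := detT x; rewrite det2 T11 mulr0 add0r => /eqP; rewrite oppr_eq0 => /eqP.
- right; exists (Q *m delta_mx 1 0).
    apply/eqP => /(congr1 (mulmx (invmx Q))); rewrite mulmx0 mulmxA mulVmx // mul1mx.
    by move/matrixP/(_ 1 0)/eqP; rewrite !mxE !eqxx oner_eq0.
  move=> x; apply: (can_inj (mulKmx Pu)); rewrite mulmx0 !mulmxA -/(T x) -colE.
  by apply/colP => i; rewrite [LHS]mxE [RHS]mxE; case: (ord2P i) => ->.
left; exists (delta_mx 0 1 *m P).
  apply/eqP => /(congr1 (mulmx^~ (invmx P))); rewrite mul0mx -mulmxA mulmxV // mulmx1.
  by move/matrixP/(_ 0 1)/eqP; rewrite !mxE !eqxx oner_eq0.
move=> x; apply: (can_inj (mulmxK Qu)); rewrite mul0mx -!mulmxA [P *m _]mulmxA -/(T x) -rowE.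
by apply/rowP => i; rewrite [LHS]mxE [RHS]mxE; case: (ord2P i) => ->.
Qed.

(* The alternatives are the two families of planes on the Klein quadric. *)
Lemma pfaffian_zero_space4 (V : zmodType) (N : V -> 'M[F]_4) : {morph N : x y / x + y} ->
  (forall x, (N x)^T = - N x) -> (forall x, pf4 (entries (N x)) 0 1 2 3 = 0) ->
  exists2 h, h \in unitmx &
    (forall x (i j : 'I_4), (0 < i)%N -> (0 < j)%N -> (h *m N x *m h^T) i j = 0) \/
    (forall x (j : 'I_4), (h *m N x *m h^T) ord_max j = 0).
Proof.
move=> ND sk pf0.
have pf0' (h : 'M_4) x : pf4 (entries (h *m N x *m h^T)) 0 1 2 3 = 0.
  apply: pf4_rank; first by apply/entries_skew/congr_skew.
  rewrite mk_entries; apply: leq_ltn_trans (mxrankM_maxl _ _) _.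
  apply: leq_ltn_trans (mxrankM_maxr _ _) _; rewrite -[N x]mk_entries.
  by apply: leq_ltn_trans (rank_pf4 (entries_skew (sk x)) (pf0 x)) _.
have [N0|/existsNP[x0 /eqP nz]] := pselect (forall x, N x = 0).
  by exists 1%:M; [exact: unitmx1|left=> x i j _ _; rewrite N0 mulmx0 mul0mx mxE].
have rk0 : (\rank (N x0) <= 2)%N.
  by rewrite -[N x0]mk_entries; apply: rank_pf4 (entries_skew (sk x0)) (pf0 x0).
have [g gu gN] := rank2_normal_form (sk x0) rk0.
pose M x := g *m N x *m g^T.
have skM x : (M x)^T = - M x by apply: congr_skew.
have MD x y : M (x + y) = M x + M y by rewrite /M ND mulmxDr mulmxDl.
pose m x i j := entries (M x) i j.
have mD i j : {morph (m ^~ i)^~ j : x y / x + y}.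
  by move=> x y; rewrite /m /entries MD mxE.
have Mnz : M x0 != 0.
  apply: contraNneq nz => M0; apply/eqP; apply: (can_inj (mulKmx gu)); rewrite mulmx0.
  apply: (can_inj (mulmxK (_ : g^T \in unitmx))); first by rewrite unitmx_tr.
  by rewrite mul0mx.
have m01 : m x0 0%N 1%N != 0 by apply: normal_form_neq0.
have z0 i j : (i < 4)%N -> (1 < j < 4)%N -> m x0 i j = 0.
  by move=> i4 /andP[j1 j4]; apply: gN; rewrite !inordK // j1 orbT.
have pfm x : pf4 (m x) 0 1 2 3 = 0 by apply: pf0'.
(* As [M x0] is a multiple of e0^e1, the Pfaffians at x0 + x and x differ by m01(x0) m23(x). *)
have m23 x : m x 2%N 3%N = 0.
  have := pfm (x0 + x); have := pfm x; rewrite /pf4 !mD !(z0 _ 2%N) // !(z0 _ 3%N) //.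
  move=> p1 p2; apply: (mulfI m01).
  rewrite mulr0 -[RHS]subr0 -[X in _ = X - _]p2 -[X in _ = _ - X]p1.
  ring.
have mq x : m x 0%N 2%N * m x 1%N 3%N = m x 0%N 3%N * m x 1%N 2%N.
  by apply/eqP; rewrite -subr_eq0 -oppr_eq0 -(pfm x) /pf4 m23; apply/eqP; ring.
pose S x : 'M[F]_2 := \matrix_(i, j) m x i (2 + j)%N.
have skx x := entries_skew (skM x).
have ME x : M x = mk 4 (m x) by rewrite mk_entries.
have tr_congr h x : (h *m g) *m N x *m (h *m g)^T = h *m M x *m h^T.
  by rewrite /M trmx_mul !mulmxA.
have [||[u nzu uS]|[v nzv vS]] := @singular_space2 V S.
- by move=> x y; apply/matrixP => i j; rewrite !mxE mD.
- by move=> x; rewrite det2 !mxE /= mq subrr.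
(* A common left kernel vector gives a combination u of e0, e1 orthogonal to e2 and e3; with m23 =
   0, the space <u, e2, e3> is isotropic. [T] replaces e0, e1 by a complement w and u. *)
- have uj x (j : 'I_2) : u 0 0 * m x 0%N (2 + j)%N + u 0 1 * m x 1%N (2 + j)%N = 0.
    have /matrixP/(_ 0 j) := uS x; rewrite !mxE !big_ord_recl big_ord0 !mxE /= addr0 => <-.
    by congr (_ + u _ _ * _); apply/val_inj.
  have u2 x : u 0 0 * m x 0%N 2%N + u 0 1 * m x 1%N 2%N = 0 by apply: (uj x 0).
  have u3 x : u 0 0 * m x 0%N 3%N + u 0 1 * m x 1%N 3%N = 0 by apply: (uj x 1).
  have [w0 [w1 d]] : exists w0 w1, w0 * u 0 1 - w1 * u 0 0 != 0.
    have [u1|u1] := eqVneq (u 0 1) 0; last by exists 1, 0; rewrite mul1r mul0r subr0.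
    exists 0, 1; rewrite mul1r mul0r sub0r oppr_eq0; apply: contraNneq nzu => u0.
    by apply/eqP/rowP => i; rewrite mxE; case: (ord2P i) => ->.
  set dd := (X in X != 0) in d.
  pose T i j := nth 0 (nth [::] [:: [:: w0; w1; 0; 0]; [:: u 0 0; u 0 1; 0; 0];
    [:: 0; 0; 1; 0]; [:: 0; 0; 0; 1]] i) j.
  pose T' i j := nth 0 (nth [::] [:: [:: u 0 1; - w1; 0; 0]; [:: - u 0 0; w0; 0; 0];
    [:: 0; 0; dd; 0]; [:: 0; 0; 0; dd]] i) j.
  have Tu : mk 4 T \in unitmx.
    apply: (@unit_table 4 T T' dd) => //; apply/matrixP => i j.
    rewrite !mxE !big_ord_recl big_ord0 !mxE /T /T' /dd.
    by case: i => [[|[|[|[|//]]]] ?]; case: j => [[|[|[|[|//]]]] ?] /=;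
    rewrite ?mulr1n ?mulr0n; ring.
  exists (mk 4 T *m g); first by rewrite unitmx_mul Tu.
  left=> x i j i0 j0; rewrite tr_congr ME mk_congr mxE.
  rewrite !(sum4 (fun k => (\sum_(l < 4) T i l * m x l k) * T j k)).
  rewrite !(sum4 (fun l => T i l * m x l _)) /T.
  have sx k l : m x l k = - m x k l by apply: (skx x).1.
  have dx k : m x k k = 0 by apply: (skx x).2.
  have e2 := u2 x; have e3 := u3 x.
  have e23 := m23 x.
  case: i i0 => [[|[|[|[|//]]]] ?] // _; case: j j0 => [[|[|[|[|//]]]] ?] // _ /=;
    rewrite !(dx, mul0r, mulr0, addr0, add0r) ?(sx 0 1) ?(sx 0 2) ?(sx 0 3)
      ?(sx 1 2) ?(sx 1 3) ?(sx 2 3) ?e23;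
    first [ring | rewrite -[RHS]e2; ring | rewrite -[RHS]e3; ring
      | rewrite -[RHS]oppr0 -[in RHS]e2; ring | rewrite -[RHS]oppr0 -[in RHS]e3; ring].
(* A common right kernel vector gives a combination of e2, e3 orthogonal to e0 and e1, and to e2, e3
   by m23 = 0: it lies in every radical and is made the last basis vector. *)
have vi x (i : 'I_2) : v 0 0 * m x i 2%N + v 1 0 * m x i 3%N = 0.
  have /matrixP/(_ i 0) := vS x; rewrite !mxE !big_ord_recl big_ord0 !mxE /= addr0 => <-.
  by rewrite mulrC [v 1 0 * _]mulrC; congr (_ + _ * v _ _); apply/val_inj.
have v0 x : v 0 0 * m x 0%N 2%N + v 1 0 * m x 0%N 3%N = 0 by apply: (vi x 0).
have v1 x : v 0 0 * m x 1%N 2%N + v 1 0 * m x 1%N 3%N = 0 by apply: (vi x 1).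
have [w0 [w1 d]] : exists w0 w1, w0 * v 1 0 - w1 * v 0 0 != 0.
  have [u1|u1] := eqVneq (v 1 0) 0; last by exists 1, 0; rewrite mul1r mul0r subr0.
  exists 0, 1; rewrite mul1r mul0r sub0r oppr_eq0; apply: contraNneq nzv => u0.
  by apply/eqP/colP => i; rewrite mxE; case: (ord2P i) => ->.
set dd := (X in X != 0) in d.
pose T i j := nth 0 (nth [::] [:: [:: 1; 0; 0; 0]; [:: 0; 1; 0; 0];
  [:: 0; 0; w0; w1]; [:: 0; 0; v 0 0; v 1 0]] i) j.
pose T' i j := nth 0 (nth [::] [:: [:: dd; 0; 0; 0]; [:: 0; dd; 0; 0];
  [:: 0; 0; v 1 0; - w1]; [:: 0; 0; - v 0 0; w0]] i) j.
have Tu : mk 4 T \in unitmx.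
  apply: (@unit_table 4 T T' dd) => //; apply/matrixP => i j.
  rewrite !mxE !big_ord_recl big_ord0 !mxE /T /T' /dd.
  by case: i => [[|[|[|[|//]]]] ?]; case: j => [[|[|[|[|//]]]] ?] /=;
    rewrite ?mulr1n ?mulr0n; ring.
exists (mk 4 T *m g); first by rewrite unitmx_mul Tu.
right=> x j; rewrite tr_congr ME mk_congr mxE.
rewrite !(sum4 (fun k => (\sum_(l < 4) T 3 l * m x l k) * T j k)).
rewrite !(sum4 (fun l => T 3 l * m x l _)) /T.
have sx k l : m x l k = - m x k l by apply: (skx x).1.
have dx k : m x k k = 0 by apply: (skx x).2.
have e2 := v0 x; have e3 := v1 x.
have e23 := m23 x.
case: j => [[|[|[|[|//]]]] ?] /=;
  rewrite !(dx, mul0r, mulr0, addr0, add0r) ?(sx 0 1) ?(sx 0 2) ?(sx 0 3)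
      ?(sx 1 2) ?(sx 1 3) ?(sx 2 3) ?e23;
  first [ring | rewrite -[RHS]e2; ring | rewrite -[RHS]e3; ring
      | rewrite -[RHS]oppr0 -[in RHS]e2; ring | rewrite -[RHS]oppr0 -[in RHS]e3; ring].
Qed.

End NormalForms.

(** * Reduction to the normal form *)

Section Congruence.
Variables (F : numFieldType) (V : vectType F).
Implicit Types (phi : 'Hom(V, 'M[F]_6)) (g h : 'M[F]_6) (x y z : V).

Definition congr_map g phi x := g *m phi x *m g^T.

Lemma congr_map_linear g phi : linear (congr_map g phi).
Proof.
by move=> a x y; rewrite /congr_map linearP mulmxDr mulmxDl -scalemxAr -scalemxAl.
Qed.

HB.instance Definition _ g phi :=
  GRing.isLinear.Build F V 'M[F]_6 *:%R (congr_map g phi) (congr_map_linear g phi).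

Definition congr_hom g phi : 'Hom(V, 'M[F]_6) := linfun (congr_map g phi).

Lemma congr_homE g phi x : congr_hom g phi x = g *m phi x *m g^T.
Proof. by rewrite /congr_hom lfunE. Qed.

(* Stability excludes the next two configurations: a common isotropic 3-space,
   and a vector [w] of [W] such that all the forms [phi x (w, _)] are proportional. *)
Definition isotropic3 phi := exists2 g : 'M[F]_6, g \in unitmx &
  forall x (i j : 'I_6), (2 < i)%N -> (2 < j)%N -> (g *m phi x *m g^T) i j = 0.

Definition narrow phi := exists2 g : 'M[F]_6, g \in unitmx &
  forall x (j : 'I_6), (0 < j)%N -> (g *m phi x *m g^T) ord_max j = 0.

(** Collects what is kept from the hypotheses on A in a form invariant under every invertible change
    of basis of W. *)
Definition admissible phi := [/\ lker phi = 0%VS, is_skew phi,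
  forall x, (\rank (phi x) <= 4)%N, ~ isotropic3 phi & ~ narrow phi].

Lemma congr_mul g h phi x : h *m congr_hom g phi x *m h^T = (h *m g) *m phi x *m (h *m g)^T.
Proof. by rewrite congr_homE trmx_mul !mulmxA. Qed.

Lemma admissible_congr g phi : g \in unitmx -> admissible phi -> admissible (congr_hom g phi).
Proof.
move=> gu [ker sk rk niso nnar]; split.
- apply/eqP; rewrite -subv0; apply/subvP => x; rewrite memv_ker congr_homE memv0 => /eqP H.
  rewrite -memv0 -ker memv_ker; apply/eqP; apply: (can_inj (mulKmx gu)); rewrite mulmx0.
  have guT : g^T \in unitmx by rewrite unitmx_tr.
  by apply: (can_inj (mulmxK guT)); rewrite mul0mx.
- by move=> x; rewrite congr_homE; apply: congr_skew.
- by move=> x; rewrite congr_homE rank_congr.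
- move=> [h hu H]; apply: niso; exists (h *m g) => [|x i j i2 j2].
    by rewrite unitmx_mul hu.
  by rewrite -congr_mul H.
- move=> [h hu H]; apply: nnar; exists (h *m g) => [|x j j0].
    by rewrite unitmx_mul hu.
  by rewrite -congr_mul H.
Qed.

Lemma two_planes_congr g phi : g \in unitmx -> two_planes (congr_hom g phi) -> two_planes phi.
Proof.
move=> gu [V1 [V2 [d1 d2 H]]]; exists V1, V2; split=> // x.
by rewrite -H congr_homE rank_congr.
Qed.

Lemma conic_case_congr g phi : g \in unitmx -> conic_case (congr_hom g phi) -> conic_case phi.
Proof.
move=> gu [d [Y fY H]]; split=> //; exists Y => // x.
by rewrite -H congr_homE rank_congr.
Qed.

Lemma entl_skew phi i j x : is_skew phi -> entl phi j i x = - entl phi i j x.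
Proof. by move=> sk; apply: (entries_skew (sk x)).1. Qed.

Lemma entl_diag phi i x : is_skew phi -> entl phi i i x = 0.
Proof. by move=> sk; apply: (entries_skew (sk x)).2. Qed.

Lemma entl_pf6 phi x : admissible phi -> pf6 (entries (phi x)) = 0.
Proof.
move=> [_ sk rk _ _]; apply: pf6_rank; first exact: entries_skew.
by rewrite mk_entries; apply: leq_ltn_trans (rk x) _.
Qed.

Lemma base_form_exists phi z : admissible phi -> \rank (phi z) = 2 ->
  exists2 g, g \in unitmx & base_form (congr_hom g phi) z.
Proof.
move=> [ker sk rk _ _] rz.
have [||g gu gN] := @rank2_normal_form _ _ (phi z); [exact: sk|by rewrite rz|].
exists g => //.
have z0 i j : (i < 6)%N -> (j < 6)%N -> (1 < i)%N || (1 < j)%N ->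
    entl (congr_hom g phi) i j z = 0.
  by move=> i6 j6 ij; rewrite /entl congr_homE /entries gN // !inordK.
split=> [|i j i6 /andP[j1 j6]]; last by rewrite z0 ?j1 ?orbT.
apply/eqP => e01; have : \rank (g *m phi z *m g^T) = 2 by rewrite rank_congr.
suff -> : g *m phi z *m g^T = 0 by rewrite mxrank0.
have [skm dgm] := entries_skew (congr_skew g (sk z)).
rewrite -congr_homE -[LHS]mk_entries; apply/matrixP => i j.
rewrite mxE [RHS]mxE -/(entl _ _ _ _).
have [ij|] := boolP ((1 < i)%N || (1 < j)%N); first exact: z0.
have sk' : is_skew (congr_hom g phi) by move=> x; rewrite congr_homE; apply: congr_skew.
case: i => [[|[|//]] ?]; case: j => [[|[|//]] ?] //= _; rewrite ?e01 ?entl_diag //.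
by rewrite entl_skew // e01 oppr0.
Qed.

(** The Pfaffians of [phi (x + z)] and [phi x] both vanish, and they differ by the e0^e1 coefficient
    of [phi z] times this 4 x 4 Pfaffian. *)
Lemma pf4_restriction phi z x : admissible phi -> base_form phi z ->
  pf4 (entries (phi x)) 2 3 4 5 = 0.
Proof.
move=> adm [zc z0]; have p1 := entl_pf6 x adm; have p2 := entl_pf6 (x + z) adm.
apply: (mulfI zc); rewrite mulr0 -[RHS]subr0 -[X in _ = X - _]p2 -[X in _ = _ - X]p1.
have eD i j : entries (phi (x + z)) i j = entries (phi x) i j + entl phi i j z.
  by rewrite /entl /entries linearD mxE.
rewrite /pf6 /pf4 !eD !(z0 _ 2%N) // !(z0 _ 3%N) // !(z0 _ 4%N) // !(z0 _ 5%N) // /entl.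
ring.
Qed.

Lemma block_congr (g : 'M[F]_4) (M : 'M[F]_(2 + 4)) :
  block_mx 1%:M 0 0 g *m M *m (block_mx 1%:M 0 0 g)^T =
  block_mx (ulsubmx M) (ursubmx M *m g^T) (g *m dlsubmx M) (g *m drsubmx M *m g^T).
Proof.
rewrite -{1}[M]submxK tr_block_mx !mulmx_block !trmx0 !trmx1.
by rewrite !mul0mx !mulmx0 !mul1mx !mulmx1 !addr0 !add0r.
Qed.

(** Of the two families of [pfaffian_zero_space4] on <e2,...,e5>, the first is a common isotropic
    3-space and is excluded; in the second the common radical vector becomes e5. The change of basis
    fixes e0 and e1, so it preserves the base form. *)
Lemma lower_zero_exists phi z : admissible phi -> base_form phi z ->
  exists2 g, g \in unitmx & base_form (congr_hom g phi) z /\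
    forall x j, (1 < j < 5)%N -> entl (congr_hom g phi) 5 j x = 0.
Proof.
move=> adm bz; have [ker sk rk niso _] := adm.
pose N x : 'M[F]_4 := drsubmx (phi x : 'M_(2 + 4)).
have NE x i j : (i < 4)%N -> (j < 4)%N -> entries (N x) i j = entries (phi x) i.+2 j.+2.
  move=> i4 j4; rewrite /entries /N !mxE; congr (phi x _ _); apply/val_inj;
  by rewrite /= !inordK.
have ND : {morph N : x y / x + y}.
  by move=> x y; rewrite /N linearD; apply/matrixP => i j; rewrite !mxE.
have skN x : (N x)^T = - N x.
  by apply/matrixP => i j; rewrite !mxE -(skewE _ _ (sk x)).
have pfN x : pf4 (entries (N x)) 0 1 2 3 = 0.
  by rewrite -[RHS](pf4_restriction x adm bz) /pf4 !NE.
have [h hu hN] := pfaffian_zero_space4 ND skN pfN.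
pose g : 'M[F]_6 := block_mx (1%:M : 'M_2) 0 0 h.
have gu : g \in unitmx.
  by rewrite unitmxE (@det_ublock _ 2 4) det1 mul1r -unitmxE.
have cE x : congr_hom g phi x = block_mx (ulsubmx (phi x : 'M_(2 + 4)))
    (ursubmx (phi x : 'M_(2 + 4)) *m h^T)
    (h *m dlsubmx (phi x : 'M_(2 + 4))) (h *m N x *m h^T) :> 'M_(2 + 4).
  by rewrite congr_homE (block_congr h (phi x)).
have dr x i j : (i < 4)%N -> (j < 4)%N ->
    entl (congr_hom g phi) i.+2 j.+2 x = (h *m N x *m h^T) (inord i) (inord j).
  move=> i4 j4; rewrite /entl /entries cE.
  rewrite (_ : inord i.+2 = rshift 2 (inord i : 'I_4)); last first.
    by apply/val_inj; rewrite /= !inordK.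
  rewrite (_ : inord j.+2 = rshift 2 (inord j : 'I_4)); last first.
    by apply/val_inj; rewrite /= !inordK.
  exact: (@block_mxEdr F 2 4 2 4).
case: hN => [hN|hN].
  case: niso; exists g => // x i j i2 j2; rewrite -congr_homE.
  have := dr x (i - 2)%N (j - 2)%N; rewrite !ltn_subLR ?(ltnW i2) ?(ltnW j2) //.
  move=> /(_ (ltn_ord i) (ltn_ord j)).
  have -> : (i - 2).+2 = i by rewrite -addn2 subnK // ltnW.
  have -> : (j - 2).+2 = j by rewrite -addn2 subnK // ltnW.
  rewrite /entl /entries !inord_val => ->; apply: hN.
    by rewrite inordK ?subn_gt0 // ltn_subLR // ltnW.
  by rewrite inordK ?subn_gt0 // ltn_subLR // ltnW.
exists g => //; split; last first.
  move=> x j /andP[j1 j5]; have -> : j = (j - 2).+2 by rewrite -addn2 subnK.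
  rewrite (dr x 3%N) ?ltn_subLR //; last exact: ltnW.
  by rewrite (_ : inord 3 = ord_max) ?hN //; apply/val_inj; rewrite /= inordK.
have [zc z0] := bz.
have ul i j : (i < 2)%N -> (j < 2)%N -> entl (congr_hom g phi) i j z = entl phi i j z.
  move=> i2 j2; rewrite /entl /entries cE.
  have [i6 j6] : (i < 6)%N /\ (j < 6)%N.
    by split; [apply: leq_trans i2 _|apply: leq_trans j2 _].
  rewrite (_ : inord i = lshift 4 (inord i : 'I_2)); last by apply/val_inj; rewrite /= !inordK.
  rewrite (_ : inord j = lshift 4 (inord j : 'I_2)); last by apply/val_inj; rewrite /= !inordK.
  apply: etrans (@block_mxEul F 2 4 2 4 _ _ _ _ _ _) _; rewrite !mxE.
  by congr (phi z _ _); apply/val_inj; rewrite /= !inordK.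
have ur0 : ursubmx (phi z : 'M_(2 + 4)) = 0.
  apply/matrixP => i j; have i6 : (i < 6)%N by apply: leq_trans (ltn_ord i) _.
  have j6 : (2 + j < 6)%N by apply: (ltn_ord (rshift 2 j)).
  rewrite !mxE -[RHS](z0 i (2 + j)%N) // /entl /entries.
  by congr (phi z _ _); apply/val_inj; rewrite /= inordK.
have N0 : N z = 0.
  rewrite -[N z]mk_entries; apply/matrixP => i j; rewrite mxE [RHS]mxE NE //.
  by apply: z0; [exact: (ltn_ord i)|exact: (ltn_ord j)].
split; first by rewrite ul.
move=> i j i6 /andP[j1 j6]; have [i2|i2] := ltnP i 2.
  rewrite /entl /entries cE ur0 N0 mul0mx.
  rewrite (_ : inord i = lshift 4 (inord i : 'I_2)); last by apply/val_inj; rewrite /= !inordK.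
  rewrite (_ : inord j = rshift 2 (inord (j - 2) : 'I_4)); last first.
    by apply/val_inj; rewrite /= !inordK ?ltn_subLR // subnKC.
  by apply: etrans (@block_mxEur F 2 4 2 4 _ _ _ _ _ _) _; rewrite mxE.
have -> : j = (j - 2).+2 by rewrite -addn2 subnK.
have -> : i = (i - 2).+2 by rewrite -addn2 subnK.
by rewrite dr ?ltn_subLR // N0 mulmx0 mul0mx mxE.
Qed.

End Congruence.

Ltac cases6 i := case: i => [|[|[|[|[|[|//]]]]]].

(** * Consequences of the absence of isotropic 3-spaces and narrow vectors *)

Section Nondegeneracy.
Variables (F : numFieldType) (V : vectType F).
Implicit Types (phi : 'Hom(V, 'M[F]_6)) (g h : 'M[F]_6) (x y z : V).

Definition fsum6 (f : nat -> F) := f 0%N + f 1%N + f 2%N + f 3%N + f 4%N + f 5%N.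

Lemma entl_congr T phi i j x : (i < 6)%N -> (j < 6)%N ->
  entl (congr_hom (mk 6 T) phi) i j x =
  fsum6 (fun k => fsum6 (fun l => T i l * entl phi l k x) * T j k).
Proof.
move=> i6 j6; rewrite /entl congr_homE -{1}[phi x]mk_entries mk_congr entries_mk //.
rewrite (sum6 (fun k => (\sum_(l < 6) T i l * entries (phi x) l k) * T j k)).
by rewrite !(sum6 (fun l => T i l * entries (phi x) l _)).
Qed.

(** Rows may be truncated: missing entries are 0. *)
Definition rows_table (s : seq (seq F)) i j := nth 0 (nth [::] s i) j.

Lemma unit_rows s s' (a : F) : a != 0 ->
  (forall i j, (i < 6)%N -> (j < 6)%N ->
    fsum6 (fun k => rows_table s i k * rows_table s' k j) = if i == j then a else 0) ->
  mk 6 (rows_table s) \in unitmx.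
Proof.
move=> a0 H; apply: (@unit_table _ 6 _ (rows_table s') a) => //; apply/matrixP => i j.
have -> : a%:M i j = if i == j :> nat then a else 0 by rewrite mxE -val_eqE; case: eqP.
rewrite -H // mxE; apply: etrans (sum6 (fun k => rows_table s i k * rows_table s' k j)).
by apply: eq_bigr => k _; rewrite !mxE.
Qed.

Definition lower_zero phi := forall x j, (1 < j < 5)%N -> entl phi 5 j x = 0.

Lemma entl_last phi j x : is_skew phi -> lower_zero phi -> (1 < j < 5)%N -> entl phi j 5 x = 0.
Proof. by move=> sk h5 jb; rewrite entl_skew // h5 ?oppr0. Qed.

(** The contractions of e5 have only the coordinates al1 and al2 up to sign. A linear relation
    between these leaves a single coordinate after a change of basis of <e0, e1>, so e5 would be a
    narrow vector. *)
Lemma tails_independent phi : admissible phi -> lower_zero phi ->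
  forall k1 k2, (forall x, k1 * entl phi 0 5 x + k2 * entl phi 1 5 x = 0) -> k1 = 0 /\ k2 = 0.
Proof.
move=> [_ sk _ _ nnar] h5 k1 k2 H; apply: contrapT => nz; apply: nnar.
have nar s : mk 6 (rows_table s) \in unitmx ->
    (forall x j, (0 < j < 6)%N ->
      entl (congr_hom (mk 6 (rows_table s)) phi) 5 j x = 0) -> narrow phi.
  move=> su Hs; exists (mk 6 (rows_table s)) => // x j j0.
  have := Hs x j; rewrite j0 ltn_ord => /(_ isT); rewrite /entl /entries congr_homE inord_val.
  by rewrite (_ : inord 5 = ord_max) //; apply/val_inj; rewrite /= inordK.
have [k20|k20] := eqVneq k2 0.
  have k10 : k1 != 0 by apply/eqP => k10; apply: nz.
  have m05 x : entl phi 0 5 x = 0.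
    by apply: (mulfI k10); have := H x; rewrite k20 mul0r addr0 mulr0.
  pose s : seq (seq F) := 
    [:: [:: 0; 1]; [:: 1]; [:: 0; 0; 1];
     [:: 0; 0; 0; 1]; [:: 0; 0; 0; 0; 1]; [:: 0; 0; 0; 0; 0; 1]].
  apply: (nar s).
    apply: (@unit_rows s s 1); first exact: oner_neq0.
    by move=> i j; cases6 i => _; cases6 j => _ /=; rewrite /fsum6 /rows_table /=; ring.
  move=> x j /andP[j0 j6]; rewrite entl_congr // /fsum6 /rows_table.
  have e0 : entl phi 5 0 x = 0 by rewrite entl_skew // m05 oppr0.
  have e5 : entl phi 5 5 x = 0 by rewrite entl_diag.
  have hs := (h5 x 2%N isT, h5 x 3%N isT, h5 x 4%N isT, e5, e0).
  move: j0 j6; cases6 j => //= _ _; rewrite ?hs; ring.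
pose s : seq (seq F) := 
  [:: [:: 1]; [:: k1; k2]; [:: 0; 0; 1];
   [:: 0; 0; 0; 1]; [:: 0; 0; 0; 0; 1]; [:: 0; 0; 0; 0; 0; 1]].
pose s' : seq (seq F) := 
  [:: [:: k2]; [:: - k1; 1]; [:: 0; 0; k2];
   [:: 0; 0; 0; k2]; [:: 0; 0; 0; 0; k2]; [:: 0; 0; 0; 0; 0; k2]].
apply: (nar s).
  apply: (@unit_rows s s' k2) => //.
  by move=> i j; cases6 i => _; cases6 j => _ /=; rewrite /fsum6 /rows_table /=; ring.
move=> x j /andP[j0 j6]; rewrite entl_congr // /fsum6 /rows_table.
have e1 : k1 * entl phi 5 0 x + k2 * entl phi 5 1 x = 0.
  by rewrite (entl_skew 0 5) // (entl_skew 1 5) // !mulrN -opprD H oppr0.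
have e5 : entl phi 5 5 x = 0 by rewrite entl_diag.
have hs := (h5 x 2%N isT, h5 x 3%N isT, h5 x 4%N isT, e5).
move: j0 j6; cases6 j => //= _ _; rewrite ?hs; first [ring | rewrite -[RHS]e1; ring].
Qed.

(** If k.p = 0 for a nonzero k, the forms vanish on the plane of <e2, e3, e4> with normal vector k,
    and this plane together with e5 is a common isotropic 3-space. The three cases choose a basis of
    the plane according to a nonzero coordinate of k. *)
Lemma kernel_part_surj phi : admissible phi -> lower_zero phi ->
  forall v, exists x, triple (entl phi 3 4) (entl phi 4 2) (entl phi 2 3) x = v.
Proof.
move=> [_ sk _ niso _] h5 v.
pose p : {linear V -> 'rV[F]_3} := triple (entl phi 3 4) (entl phi 4 2) (entl phi 2 3).
suff : v \in limg (linfun p) by move=> /memv_imgP[x _ ->]; exists x; rewrite lfunE.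
apply: contraT => /vspace_functional[L L0 Lv]; case: niso.
pose k34 := L (delta_mx 0 0); pose k42 := L (delta_mx 0 1); pose k23 := L (delta_mx 0 2%:R).
have LE u : L u = k34 * u 0 0 + k42 * u 0 1 + k23 * u 0 2%:R.
  have -> : u = u 0 0 *: delta_mx 0 0 + u 0 1 *: delta_mx 0 1 + u 0 2%:R *: delta_mx 0 2%:R.
    by apply: row3_ext; rewrite !mxE /=; ring.
  rewrite !linearD !linearZ /= -/k34 -/k42 -/k23 !mxE /=; ring.
have rel x : k34 * entl phi 3 4 x + k42 * entl phi 4 2 x + k23 * entl phi 2 3 x = 0.
  have := L0 (p x); rewrite -{1}[p x](lfunE p) memv_img ?memvf // => /(_ isT).
  by rewrite LE !triple3.
have iso s : mk 6 (rows_table s) \in unitmx ->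
    (forall x i j, (2 < i < 6)%N -> (2 < j < 6)%N ->
      entl (congr_hom (mk 6 (rows_table s)) phi) i j x = 0) -> isotropic3 phi.
  move=> su Hs; exists (mk 6 (rows_table s)) => // x i j i2 j2.
  have := Hs x i j; rewrite i2 j2 !ltn_ord => /(_ isT isT); rewrite /entl /entries congr_homE.
  by rewrite !inord_val.
have e5 i x : (1 < i < 6)%N -> entl phi i 5 x = 0.
  move=> /andP[i1]; rewrite ltnS leq_eqVlt => /orP[/eqP ->|i5]; first by rewrite entl_diag.
  by rewrite entl_last // i1.
have e5' i x : (1 < i < 6)%N -> entl phi 5 i x = 0.
  by move=> ib; rewrite entl_skew // e5 // oppr0.
have dg i x : entl phi i i x = 0 by rewrite entl_diag.
have [k0|k0] := eqVneq k34 0; last first.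
  pose a := - (k42 / k34); pose b := - (k23 / k34).
  pose t a b : seq (seq F) := 
    [:: [:: 1]; [:: 0; 1]; [:: 0; 0; 1];
     [:: 0; 0; a; 1]; [:: 0; 0; b; 0; 1]; [:: 0; 0; 0; 0; 0; 1]].
  have r x : entl phi 3 4 x = a * entl phi 4 2 x + b * entl phi 2 3 x * 1.
    apply: (mulfI k0); apply/eqP; rewrite -subr_eq0 -[X in _ == X](rel x); apply/eqP.
    by rewrite /a /b; field.
  apply: (iso (t a b)).
    apply: (@unit_rows _ (t (- a) (- b)) 1); first exact: oner_neq0.
    by move=> i j; cases6 i => _; cases6 j => _ /=; rewrite /fsum6 /rows_table /=; ring.
  move=> x i j /andP[i2 i6] /andP[j2 j6]; rewrite entl_congr // /fsum6 /rows_table.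
  have hs := (dg, e5 2%N x isT, e5 3%N x isT, e5 4%N x isT,
    e5' 2%N x isT, e5' 3%N x isT, e5' 4%N x isT).
  have s32 := entl_skew 2 3 x sk; have s43 := entl_skew 3 4 x sk.
  have s24 := entl_skew 4 2 x sk.
  by move: i2 i6 j2 j6; cases6 i => // _ _; cases6 j => // _ _ /=;
    rewrite !hs ?s32 ?s43 ?s24 ?r; ring.
have [k1|k1] := eqVneq k42 0; last first.
  pose b := k23 / k42.
  pose t b : seq (seq F) := 
    [:: [:: 1]; [:: 0; 1]; [:: 0; 0; 0; 1];
     [:: 0; 0; 1]; [:: 0; 0; 0; b; 1]; [:: 0; 0; 0; 0; 0; 1]].
  pose t' b : seq (seq F) := 
    [:: [:: 1]; [:: 0; 1]; [:: 0; 0; 0; 1];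
     [:: 0; 0; 1]; [:: 0; 0; b; 0; 1]; [:: 0; 0; 0; 0; 0; 1]].
  have r x : entl phi 4 2 x = - b * entl phi 2 3 x.
    apply: (mulfI k1); apply/eqP; rewrite -subr_eq0 -[X in _ == X](rel x) k0; apply/eqP.
    by rewrite /b; field.
  apply: (iso (t (- b))).
    apply: (@unit_rows _ (t' b) 1); first exact: oner_neq0.
    by move=> i j; cases6 i => _; cases6 j => _ /=; rewrite /fsum6 /rows_table /=; ring.
  move=> x i j /andP[i2 i6] /andP[j2 j6]; rewrite entl_congr // /fsum6 /rows_table.
  have hs := (dg, e5 2%N x isT, e5 3%N x isT, e5 4%N x isT,
    e5' 2%N x isT, e5' 3%N x isT, e5' 4%N x isT).
  have s32 := entl_skew 2 3 x sk; have s43 := entl_skew 3 4 x sk.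
  have s24 := entl_skew 4 2 x sk.
  by move: i2 i6 j2 j6; cases6 i => // _ _; cases6 j => // _ _ /=;
    rewrite !hs ?s32 ?s43 ?s24 ?r; ring.
have k2 : k23 != 0.
  by apply: contraNneq Lv => k2; rewrite LE k0 k1 k2 !mul0r !addr0.
have r x : entl phi 2 3 x = 0.
  by apply: (mulfI k2); have := rel x; rewrite k0 k1 !mul0r !add0r mulr0.
pose t : seq (seq F) := 
  [:: [:: 1]; [:: 0; 1]; [:: 0; 0; 0; 0; 1];
   [:: 0; 0; 1]; [:: 0; 0; 0; 1]; [:: 0; 0; 0; 0; 0; 1]].
pose t' : seq (seq F) := 
  [:: [:: 1]; [:: 0; 1]; [:: 0; 0; 0; 1];
   [:: 0; 0; 0; 0; 1]; [:: 0; 0; 1]; [:: 0; 0; 0; 0; 0; 1]].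
apply: (iso t).
  apply: (@unit_rows _ t' 1); first exact: oner_neq0.
  by move=> i j; cases6 i => _; cases6 j => _ /=; rewrite /fsum6 /rows_table /=; ring.
move=> x i j /andP[i2 i6] /andP[j2 j6]; rewrite entl_congr // /fsum6 /rows_table.
have hs := (dg, e5 2%N x isT, e5 3%N x isT, e5 4%N x isT,
    e5' 2%N x isT, e5' 3%N x isT, e5' 4%N x isT).
have s32 := entl_skew 2 3 x sk; have s43 := entl_skew 3 4 x sk.
have s24 := entl_skew 4 2 x sk.
by move: i2 i6 j2 j6; cases6 i => // _ _; cases6 j => // _ _ /=;
  rewrite !hs ?s32 ?s43 ?s24 ?r; ring.
Qed.

End Nondegeneracy.

(** * Removing the skew parts by shears and sorting into the two cases *)

Section Classification.
Variables (F : numFieldType) (V : vectType F).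
Implicit Types (phi : 'Hom(V, 'M[F]_6)) (g h : 'M[F]_6) (x y z : V).

(* Rows: [e0 + s], [e1 + t], [e_j - u_j e5] for [j = 2, 3, 4], and [e5], where [s] and
   [t] are the axial vectors of [S] and [T]. *)
Definition shear (S T : 'M[F]_3) (u : 'rV[F]_3) : 'M[F]_6 := mk 6 (rows_table
  [:: [:: 1; 0; S 1 2%:R; S 2%:R 0; S 0 1; 0]; [:: 0; 1; T 1 2%:R; T 2%:R 0; T 0 1; 0];
      [:: 0; 0; 1; 0; 0; - u 0 0]; [:: 0; 0; 0; 1; 0; - u 0 1];
      [:: 0; 0; 0; 0; 1; - u 0 2%:R]; [:: 0; 0; 0; 0; 0; 1]]).

Lemma shear_unit S T u : shear S T u \in unitmx.
Proof.
apply: (@unit_rows _ _ [:: [:: 1; 0; - S 1 2%:R; - S 2%:R 0; - S 0 1;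
      - (S 1 2%:R * u 0 0 + S 2%:R 0 * u 0 1 + S 0 1 * u 0 2%:R)];
      [:: 0; 1; - T 1 2%:R; - T 2%:R 0; - T 0 1;
      - (T 1 2%:R * u 0 0 + T 2%:R 0 * u 0 1 + T 0 1 * u 0 2%:R)];
      [:: 0; 0; 1; 0; 0; u 0 0]; [:: 0; 0; 0; 1; 0; u 0 1];
      [:: 0; 0; 0; 0; 1; u 0 2%:R]; [:: 0; 0; 0; 0; 0; 1]] 1); first exact: oner_neq0.
by move=> i j; cases6 i => _; cases6 j => _ /=; rewrite /fsum6 /rows_table /=; ring.
Qed.

Lemma mulmx3 (v : 'rV[F]_3) (S : 'M[F]_3) k :
  (v *m S) 0 k = v 0 0 * S 0 k + v 0 1 * S 1 k + v 0 2%:R * S 2%:R k.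
Proof.
rewrite mxE !big_ord_recl big_ord0 addr0 addrA.
by congr (v _ _ * S _ _ + v _ _ * S _ _ + v _ _ * S _ _); apply/val_inj.
Qed.

Lemma sub_entry (v u w : 'rV[F]_3) c k : (v - c *: u - w) 0 k = v 0 k - c * u 0 k - w 0 k.
Proof. by rewrite !mxE. Qed.

(** Removes from a and b the terms p S and p T, and a common vector u multiplied by al1 and al2,
    while al1, al2, p and the normalizations stay as they are. *)
Lemma shear_congr phi S T u : is_skew phi -> lower_zero phi -> S^T = - S -> T^T = - T ->
  let phi' := congr_hom (shear S T u) phi in
  let p := triple (entl phi 3 4) (entl phi 4 2) (entl phi 2 3) in
  [/\ forall x, triple (entl phi' 0 2) (entl phi' 0 3) (entl phi' 0 4) x =
        triple (entl phi 0 2) (entl phi 0 3) (entl phi 0 4) x - entl phi 0 5 x *: u - p x *m S,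
      forall x, triple (entl phi' 1 2) (entl phi' 1 3) (entl phi' 1 4) x =
        triple (entl phi 1 2) (entl phi 1 3) (entl phi 1 4) x - entl phi 1 5 x *: u - p x *m T,
      forall x, [/\ entl phi' 0 5 x = entl phi 0 5 x, entl phi' 1 5 x = entl phi 1 5 x &
        triple (entl phi' 3 4) (entl phi' 4 2) (entl phi' 2 3) x = p x],
      lower_zero phi' & forall z, base_form phi z -> base_form phi' z].
Proof.
move=> sk h5 skS skT phi' p.
have dg i x : entl phi i i x = 0 by rewrite entl_diag.
have hs x := (dg, h5 x 2%N isT, h5 x 3%N isT, h5 x 4%N isT,
  @entl_last _ _ phi 2 x sk h5 isT, @entl_last _ _ phi 3 x sk h5 isT,
  @entl_last _ _ phi 4 x sk h5 isT).
have ss x := (entl_skew 2 3 x sk, entl_skew 3 4 x sk, entl_skew 4 2 x sk).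
have dS i : S i i = 0 by apply: skew_diag.
have dT i : T i i = 0 by apply: skew_diag.
have S1 := (skewE 0 1 skS, skewE 1 2%:R skS, skewE 2%:R 0 skS, dS).
have T1 := (skewE 0 1 skT, skewE 1 2%:R skT, skewE 2%:R 0 skT, dT).
split.
- move=> x; apply: row3_ext; rewrite sub_entry mulmx3 /p !triple3 ?S1 /phi' /= entl_congr //
    /fsum6 /rows_table /= ?(hs x) ?(ss x); ring.
- move=> x; apply: row3_ext; rewrite sub_entry mulmx3 /p !triple3 ?T1 /phi' /= entl_congr //
    /fsum6 /rows_table /= ?(hs x) ?(ss x); ring.
- move=> x; split; [| |apply: row3_ext; rewrite /p !triple3];
    rewrite /phi' entl_congr // /fsum6 /rows_table /= ?(hs x); ring.
- move=> x j jb; rewrite /phi' entl_congr //; last by case/andP: jb => _ /ltnW.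
  by move: jb; cases6 j => // _; rewrite /fsum6 /rows_table /= !(hs x); ring.
move=> z [zc z0].
have zl i j : (i < 6)%N -> (1 < j < 6)%N -> entl phi j i z = 0.
  by move=> i6 jb; rewrite entl_skew // z0 // oppr0.
have zz := (z0 0%N 2%N isT isT, z0 0%N 3%N isT isT, z0 0%N 4%N isT isT, z0 0%N 5%N isT isT,
  z0 1%N 2%N isT isT, z0 1%N 3%N isT isT, z0 1%N 4%N isT isT, z0 1%N 5%N isT isT,
  z0 2%N 2%N isT isT, z0 2%N 3%N isT isT, z0 2%N 4%N isT isT, z0 2%N 5%N isT isT,
  z0 3%N 2%N isT isT, z0 3%N 3%N isT isT, z0 3%N 4%N isT isT, z0 3%N 5%N isT isT,
  z0 4%N 2%N isT isT, z0 4%N 3%N isT isT, z0 4%N 4%N isT isT, z0 4%N 5%N isT isT,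
  z0 5%N 2%N isT isT, z0 5%N 3%N isT isT, z0 5%N 4%N isT isT, z0 5%N 5%N isT isT).
have zt := (zl 0%N 2%N isT isT, zl 0%N 3%N isT isT, zl 0%N 4%N isT isT, zl 0%N 5%N isT isT,
  zl 1%N 2%N isT isT, zl 1%N 3%N isT isT, zl 1%N 4%N isT isT, zl 1%N 5%N isT isT).
split.
  suff -> : entl phi' 0 1 z = entl phi 0 1 z by [].
  by rewrite /phi' entl_congr // /fsum6 /rows_table /= !(zz, zt, dg); ring.
move=> i j i6 /andP[j1 j6]; rewrite /phi' entl_congr //.
by move: i6 j1 j6; cases6 i => // _; cases6 j => // _ _;
  rewrite /fsum6 /rows_table /= !(zz, zt, dg); ring.
Qed.

Theorem classification phi : admissible phi -> (exists z, \rank (phi z) = 2) ->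
  two_planes phi \/ conic_case phi.
Proof.
move=> adm0 [z /(base_form_exists adm0)[g1 gu1 bz1]].
have adm1 := admissible_congr gu1 adm0.
have [g2 gu2 [bz h5]] := lower_zero_exists adm1 bz1.
have adm2 := admissible_congr gu2 adm1.
suff : two_planes (congr_hom g2 (congr_hom g1 phi)) \/
    conic_case (congr_hom g2 (congr_hom g1 phi)).
  case=> [/(two_planes_congr gu2)/(two_planes_congr gu1)|]; first by left.
  by move=> /(conic_case_congr gu2)/(conic_case_congr gu1); right.
move: (congr_hom g2 (congr_hom g1 phi)) bz h5 adm2 =>
  {g1 g2 gu1 gu2 adm0 adm1 bz1}phi bz h5 adm.
have [ker sk rk _ _] := adm.
have ind := tails_independent adm h5; have ps := kernel_part_surj adm h5.
pose p : {linear V -> 'rV[F]_3} := triple (entl phi 3 4) (entl phi 4 2) (entl phi 2 3).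
pose a : {linear V -> 'rV[F]_3} := triple (entl phi 0 2) (entl phi 0 3) (entl phi 0 4).
pose b : {linear V -> 'rV[F]_3} := triple (entl phi 1 2) (entl phi 1 3) (entl phi 1 4).
have rel x : entl phi 0 5 x * dot (b x) (p x) = entl phi 1 5 x * dot (a x) (p x).
  have := entl_pf6 x adm; rewrite /pf6 /pf4 -!/(entl _ _ _ _).
  have hs := (@entl_last _ _ phi 2 x sk h5 isT, @entl_last _ _ phi 3 x sk h5 isT,
  @entl_last _ _ phi 4 x sk h5 isT).
  rewrite !hs (entl_skew 4 2) // !dot_triple => pf0.
  by apply/eqP; rewrite -subr_eq0 -[X in _ == X]pf0; apply/eqP; ring.
have [x1 [x2 [a11 a21 a12 a22]]] := dual_pair ind.
have [] := @pfaffian_dichotomy _ _ p ps (entl phi 0 5) (entl phi 1 5) a b ind rel.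
  move=> [u [S [T [skS skT aE bE]]]]; left.
  have [a' b' inv h5' bz'] := shear_congr u sk h5 skS skT.
  apply: (two_planes_congr (shear_unit S T u)).
  have [z1 z0] := bz' z bz.
  have admc := admissible_congr (shear_unit S T u) adm.
  move: admc a' b' inv h5' z1 z0; move: (congr_hom _ _) => phi' admc a' b' inv h5' z1 z0.
  have [_ sk' _ _ _] := admc.
  apply: two_planes_final => //.
  - move=> x i j i2 jb.
    have a0 : triple (entl phi' 0 2) (entl phi' 0 3) (entl phi' 0 4) x = 0.
      by rewrite a' -/(a x) aE addrAC addrK subrr.
    have b0 : triple (entl phi' 1 2) (entl phi' 1 3) (entl phi' 1 4) x = 0.
      by rewrite b' -/(b x) bE addrAC addrK subrr.
    case/triple_eq0: a0 => ? ? ?; case/triple_eq0: b0 => ? ? ?.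
    by case: i i2 => [|[|//]] _; case: j jb => [|[|[|[|[|//]]]]].
  - by move=> v; have [x xE] := ps v; exists x; have [_ _ ->] := inv x.
  - move=> v.
    (* The dual pair gives al1 and al2 the prescribed values; a multiple of z, on which both vanish,
       then adjusts the entry (0,1). *)
    pose w := v 0 1 *: x1 + v 0 2%:R *: x2.
    exists (w + ((v 0 0 - entl phi' 0 1 w) / entl phi' 0 1 z) *: z).
    have e1 x : entl phi' 0 5 x = entl phi 0 5 x by case: (inv x).
    have e2 x : entl phi' 1 5 x = entl phi 1 5 x by case: (inv x).
    have w1 : entl phi' 0 5 w = v 0 1.
      by rewrite e1 /w linearD !linearZ /= a11 a12 mulr1 mulr0 addr0.
    have w2 : entl phi' 1 5 w = v 0 2%:R.
      by rewrite e2 /w linearD !linearZ /= a21 a22 mulr1 mulr0 add0r.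
    apply: row3_ext; rewrite triple3 linearD linearZ /=.
    + by rewrite divfK // addrC subrK.
    + by rewrite w1 (z0 0%N 5%N) // mulr0 addr0.
    + by rewrite w2 (z0 1%N 5%N) // mulr0 addr0.
move=> [lam [u1 [u2 [S [T [[z2 pz2 lz2] [skS skT] [al1 al2] aE bE]]]]]]; right.
have [a' b' inv h5' bz'] := shear_congr 0 sk h5 skS skT.
apply: (conic_case_congr (shear_unit S T 0)).
have admc := admissible_congr (shear_unit S T 0) adm.
have bzc := bz' z bz.
move: admc a' b' inv h5' bzc {bz'}; move: (congr_hom _ _) => phi' admc a' b' inv h5' bzc.
have [ker' sk' _ _ _] := admc.
have e1 x : entl phi' 0 5 x = entl phi 0 5 x by case: (inv x).
have e2 x : entl phi' 1 5 x = entl phi 1 5 x by case: (inv x).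
have e3 x : triple (entl phi' 3 4) (entl phi' 4 2) (entl phi' 2 3) x = p x by case: (inv x).
apply: (@conic_final _ _ phi' lam u1 u2 z z2) => //.
- by move=> v; have [x xE] := ps v; exists x; rewrite e3.
- by move=> k1 k2 H; apply: ind => x; rewrite -e1 -e2.
- by rewrite e3.
- by move=> x; rewrite e1 e3; apply: al1.
- by move=> x; rewrite e2 e3; apply: al2.
- by move=> x; rewrite a' -/(a x) aE scaler0 subr0 addrK.
- by move=> x; rewrite b' -/(b x) bE scaler0 subr0 addrK.
Qed.

End Classification.

(** * The Grassmannian section *)

Section StableSections.
Variable F : numFieldType.

Lemma stable_admissible (V : vectType F) (phi : 'Hom(V, 'M[F]_6)) : lker phi = 0%VS ->
  is_skew phi -> (forall x, (\rank (phi x) <= 4)%N) ->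
  zariski_closed (SL_orbit phi) -> finite_set (SL_stabilizer phi) -> admissible phi.
Proof.
move=> ker sk rk cl fin; split=> // -[g gu H].
(* Weights (1,1,1,-1,-1,-1): negative sums occur only for two indices in the isotropic 3-space. *)
- pose w (i : 'I_6) : int := if (i < 3)%N then 1 else -1.
  apply: (@destabilize _ _ phi g w 0) fin => //.
    by rewrite !big_ord_recl big_ord0.
  move=> x i j; rewrite /w; case: ltnP => i3; case: ltnP => j3 // _.
  exact: H.
(* Weights (1,0,0,0,0,-1): a negative sum involves index 5 and an index other than 0, where the
   entries of a narrow configuration vanish. *)
pose w (i : 'I_6) : int := if i == 0%N :> nat then 1 else if i == 5%N :> nat then -1 else 0.
apply: (@destabilize _ _ phi g w 0) fin => //.
  by rewrite !big_ord_recl big_ord0.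
have skg x := congr_skew g (sk x).
have last (i : 'I_6) : i == 5%N :> nat -> i = ord_max by move/eqP => i5; apply/val_inj.
move=> x i j; rewrite /w.
have [i0|i0] := eqVneq (i : nat) 0%N; first by do 2?case: ifP.
have [j0|j0] := eqVneq (j : nat) 0%N; first by case: ifP.
case: ifP => [/last -> _|_]; first by rewrite H ?lt0n.
by case: ifP => // /last -> _; rewrite (skewE ord_max i (skg x)) H ?oppr0 ?lt0n.
Qed.

(** The principal 2 x 2 block at a nonzero entry is invertible, since its square is a nonzero
    scalar. *)
Lemma skew_rank_ge2 n (M : 'M[F]_n) : M^T = - M -> M != 0 -> (2 <= \rank M)%N.
Proof.
move=> sk nz.
have [i [j nij]] : exists i j, M i j != 0.
  apply: contrapT => H; move/eqP: nz; apply; apply/matrixP => i j; rewrite mxE.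
  by apply: contrapT => /eqP nij; apply: H; exists i, j.
pose E : 'M[F]_(2, n) := \matrix_(r, s) (nth i [:: i; j] r == s)%:R.
have EM : (E *m M *m E^T) *m (E *m M *m E^T) = (- M i j ^+ 2)%:M.
  have -> : E *m M *m E^T = mk 2 (fun r s => M (nth i [:: i; j] r) (nth i [:: i; j] s)).
    apply/matrixP => r s; rewrite !mxE (bigD1 (nth i [:: i; j] s)) //= big1 => [|t nt].
      rewrite addr0 !mxE eqxx mulr1 (bigD1 (nth i [:: i; j] r)) //= big1 => [|t nt].
        by rewrite addr0 !mxE eqxx mul1r.
      by rewrite !mxE eq_sym (negPf nt) mul0r.
    by rewrite [E^T _ _]mxE [E _ _]mxE eq_sym (negPf nt) mulr0.
  apply/matrixP => r s; rewrite !mxE !big_ord_recl big_ord0 !mxE.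
  by case: r => [[|[|//]] ?]; case: s => [[|[|//]] ?];
    rewrite /bump /= !(skew_diag _ sk) ?(skewE i j sk) ?mulr1n ?mulr0n; ring.
rewrite -(rank_scalar_factor _ EM) ?oppr_eq0 ?expf_neq0 //.
apply: leq_trans (mxrankM_maxl _ _) _; exact: mxrankM_maxr.
Qed.

Variables (A : {vspace 'M[F]_6}) (V : vectType F) (phi : 'Hom(V, 'M[F]_6)).
Hypotheses (ker : lker phi = 0%VS) (img : limg phi = A) (sk : is_skew phi).

Lemma mem_section x v : val x = <[v]>%VS -> v != 0 ->
  (projlin A `&` Gr) x <-> exists2 z, v = phi z & (\rank (phi z) <= 2)%N.
Proof.
move=> xv nz; split=> [[]|[z vz rz]].
  rewrite /projlin /= xv -memvE -img => /memv_imgP[z _ vz] G.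
  have [|_ rv] := G v _ nz; first by rewrite xv memv_line.
  by exists z; rewrite // -vz rv.
split; first by rewrite /projlin /= xv -memvE -img vz memv_img ?memvf.
move=> M; rewrite xv => /vlineP[k ->] kv; split.
  by rewrite /skew_forms /= vz linearZ /= sk scalerN.
have skM : (k *: v)^T = - (k *: v) by rewrite vz linearZ /= sk scalerN.
apply/eqP; rewrite eqn_leq (skew_rank_ge2 skM kv) andbT; apply: leq_trans rz.
by rewrite -vz; apply/mxrankS/scalemx_sub/submx_refl.
Qed.

Lemma section_two_planes (V1 V2 : {vspace V}) :
  (forall x, (\rank (phi x) <= 2)%N <-> x \in V1 \/ x \in V2) ->
  projlin A `&` Gr = projlin (phi @: V1) `|` projlin (phi @: V2).
Proof.
move=> H; apply/seteqP; split=> x; have [v nz xv] := proj_gen x.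
  move=> /(mem_section xv nz)[z vz /H zV].
  by case: zV => zV; [left|right]; rewrite /projlin /= xv -memvE vz memv_img.
move=> xV; apply/(mem_section xv nz); case: xV;
  rewrite /projlin /= xv -memvE => /memv_imgP[z zV vz]; exists z => //; apply/H.
  by left.
by right.
Qed.

Lemma section_conic (Y : 3.-tuple V) :
  (forall x, (\rank (phi x) <= 2)%N <-> exists k s t, x = k *: veronese Y s t) ->
  projlin A `&` Gr = conic [tuple of map phi Y].
Proof.
have vE s t : veronese [tuple of map phi Y] s t = phi (veronese Y s t).
  by rewrite /veronese /lin3 !linearD !linearZ /= !(nth_map 0) ?size_tuple.
move=> H; apply/seteqP; split=> x; have [v nz xv] := proj_gen x.
  move=> /(mem_section xv nz)[z vz /H[k [s [t zE]]]].
  exists s, t; rewrite xv vE vz zE linearZ vlineZ //.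
  by apply: contraNneq nz => k0; rewrite vz zE k0 scale0r linear0.
move=> [s [t xE]]; apply/(mem_section xv nz).
have /vlineP[k vk] : v \in <[phi (veronese Y s t)]>%VS by rewrite -vE -xE xv memv_line.
exists (k *: veronese Y s t); first by rewrite linearZ.
by apply/H; exists k, s, t.
Qed.

Lemma free_img (Y : 3.-tuple V) : free Y -> free [tuple of map phi Y].
Proof.
move=> fY; apply/freeP => k; move/freeP: fY => fY H; apply: fY.
apply/eqP; rewrite -memv0 -ker memv_ker linear_sum /= -[X in _ == X]H; apply/eqP.
by apply: eq_bigr => i _; rewrite linearZ /= (nth_map 0) ?size_tuple.
Qed.

Lemma dim_img (U : {vspace V}) : \dim (phi @: U) = \dim U.
Proof. by rewrite limg_dim_eq // ker capv0. Qed.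

End StableSections.

Theorem proposition4p4 (R : realType) (n : nat) (A : {vspace 'M[R[i]]_6})
    (skewA : forall M, M \in A -> skew_forms M)
    (dimA : \dim A = n.+1)
    (A_sub_Pf : projlin A `<=` Pf)
    (stableA : stable A)
    (A_meets_Gr : projlin A `&` Gr !=set0) :
  exists d : nat,
    [/\ has_dim (projlin A `&` Gr) d,
        (d + 3 <= n)%N
      & forall Z, irr_component Z (projlin A `&` Gr) -> has_dim Z d ->
          smooth Z].
Proof.
have [phi [ker img cl fin]] := stableA.
have memA x : phi x \in A.
  by suff: phi x \in limg phi; [rewrite img|apply: memv_img; apply: memvf].
have sk : is_skew phi by move=> x; apply: skewA.
have rk x : (\rank (phi x) <= 4)%N.
  have [->|nz] := eqVneq (phi x) 0; first by rewrite mxrank0.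
  have [] // := A_sub_Pf (line nz) _ (phi x); last exact: memv_line.
  by rewrite /projlin /= -memvE.
have adm := stable_admissible ker sk rk cl fin.
have [x0 x0A] := A_meets_Gr; have [v0 nz0 xv0] := proj_gen x0.
have rk2 : exists z, \rank (phi z) = 2.
  have [z vz rz] := (mem_section img sk xv0 nz0).1 x0A.
  have z0 : phi z != 0 by rewrite -vz.
  by exists z; apply/eqP; rewrite eqn_leq rz (skew_rank_ge2 (sk z) z0).
have dimV : \dim (fullv : {vspace 'rV[R[i]]_(\dim A)}) = n.+1.
  by rewrite dimvf /dim /= mul1n.
have [[V1 [V2 [d1 d2 H]]]|[d5 [Y fY H]]] := classification adm rk2.
  rewrite (section_two_planes img sk H) in x0A *.
  move: d1 d2; rewrite dimV -!(dim_img ker) => d1 d2.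
  have nz : ((phi @: V1)%VS != 0%VS) || ((phi @: V2)%VS != 0%VS).
    by case: x0A => xV; rewrite (projlin_nonempty (ex_intro _ x0 xV) (@subset_refl _ _)) ?orbT.
  have dmax : (0 < maxn (\dim (phi @: V1)) (\dim (phi @: V2)))%N.
    by rewrite leq_max !lt0n !dimv_eq0.
  exists (maxn (\dim (phi @: V1)) (\dim (phi @: V2))).-1; split.
  - exact: has_dim_union.
  - by rewrite -ltnS -addSn prednK // addn_maxl geq_max d1.
  - by move=> Z /component_union[D nzD ->] _; apply: smooth_projlin.
rewrite (section_conic img sk H); have fY' := free_img ker fY.
exists 1%N; split; first exact: has_dim_conic.
  (* Here dim A = 5 gives n = 4, so the codimension is exactly 3. *)
  by move: d5; rewrite dimV => -[->].
(* The conic is irreducible, so maximality identifies [Z] with it. *)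
move=> Z [irrZ ZC maxZ] _.
by rewrite -(maxZ _ (irreducible_conic fY') ZC (@subset_refl _ _)); apply: smooth_conic.
Qed.
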